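(* Let $d\in\mathbb{N}$, let $w(k)>0$, $k\in\mathbb{Z}^d$, be weights with $\sum_{k\in\mathbb{Z}^d}w(k)^{-2}<\infty$, and let $(\sigma_j)_{j\in\mathbb{N}}$ be the non-increasing rearrangement of $(1/w(k))_{k\in\mathbb{Z}^d}$. Let $G_d$ be any one of the spaces $\mathcal{A}(\mathbb{T}^d)$, $C(\mathbb{T}^d)$, $L_\infty(\mathbb{T}^d)$. Then for all $n\in\mathbb{N}$ $$a_n(I_d:F_d(w)\to G_d)=\Big(\sum_{j=n}^\infty\sigma_j^2\Big)^{1/2}.$$ (Equivalently, since $\sigma_j=a_j(I_d:F_d(w)\to L_2(\mathbb{T}^d))$, one has $a_n(I_d:F_d(w)\to G_d)=\big(\sum_{j\ge n}a_j(I_d:F_d(w)\to L_2(\mathbb{T}^d))^2\big)^{1/2}$.)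
   Context: $\mathbb{T}^d=[0,2\pi)^d$ is the $d$-dimensional torus with the normalized Lebesgue measure $(2\pi)^{-d}dx$; all $L_p(\mathbb{T}^d)$-norms refer to this measure. For $f\in L_1(\mathbb{T}^d)$, $\hat f(k)=(2\pi)^{-d}\int_{\mathbb{T}^d}f(x)e^{-ik\cdot x}dx$. For weights $w(k)>0$, $F_d(w)$ is the Hilbert space of all $f\in L_1(\mathbb{T}^d)$ with $\|f|F_d(w)\|=\big(\sum_{k}w(k)^2|\hat f(k)|^2\big)^{1/2}<\infty$. $\mathcal{A}(\mathbb{T}^d)$ (Wiener algebra) is the Banach space of $f\in L_1(\mathbb{T}^d)$ with $\|f|\mathcal{A}(\mathbb{T}^d)\|=\sum_k|\hat f(k)|<\infty$; $C(\mathbb{T}^d)$ is the space of continuous periodic functions with sup-norm; functions having a continuous representative are identified with it. $I_d$ denotes the inclusion map. For a bounded linear operator $T:X\to Y$ between Banach spaces, $a_n(T)=\inf\{\|T-A\|: A:X\to Y \text{ bounded linear},\ \operatorname{rank}A<n\}$. *)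

(* Defs.v *)
From HB Require Import structures.
From mathcomp Require Import all_boot all_order all_algebra.
From mathcomp Require Import all_classical all_reals all_analysis.
From mathcomp Require Import complex.
Set Implicit Arguments. Unset Strict Implicit. Unset Printing Implicit Defensive.
Import Order.TTheory GRing.Theory Num.Theory.
Import numFieldNormedType.Exports.
Local Open Scope classical_set_scope.
Local Open Scope ring_scope.

Section Torus.
Variable R : realType.

(* points of R^d : d-tuples of reals; the torus T^d = [0,2pi)^d is modelled by
   functions on R^d, only their restriction to the cube [0,2pi)^d matters for
   the measure below (which is concentrated on that cube). *)
Definition pt (d : nat) := d.-tuple R.
Definition freq (d : nat) := d.-tuple int.

Definition per_int : set R := [set x : R | 0 <= x < 2 * pi].
Definition mu1 : set R -> \bar R :=
  fun A => (((2 * pi) ^-1)%:E * lebesgue_measure (A `&` per_int))%E.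

Fixpoint tmeas (d : nat) : set (pt d) -> \bar R :=
  match d with
  | 0 => fun A => (\d_([tuple] : 0.-tuple R) A)%E
  | d'.+1 => fun A =>
      ((@tmeas d' \x mu1) [set p : pt d' * R | [tuple of p.2 :: p.1] \in A])%E
  end.

Definition cabs (z : R[i]) : R := Num.sqrt (complex.Re z ^+ 2 + complex.Im z ^+ 2).

Definition cint d (f : pt d -> R[i]) : R[i] :=
  @Complex R (fine (\int[@tmeas d]_x (complex.Re (f x))%:E)%E)
          (fine (\int[@tmeas d]_x (complex.Im (f x))%:E)%E).

Definition L1 d (f : pt d -> R[i]) : Prop :=
  measurable_fun [set: pt d] (fun x => complex.Re (f x)) /\
  measurable_fun [set: pt d] (fun x => complex.Im (f x)) /\
  (\int[@tmeas d]_x (cabs (f x))%:E < +oo)%E.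

Definition dotkx d (k : freq d) (x : pt d) : R :=
  \sum_(i < d) (tnth k i)%:~R * tnth x i.

Definition cexpm d (k : freq d) (x : pt d) : R[i] :=
  @Complex R (cos (dotkx k x)) (- sin (dotkx k x)).

(* Fourier coefficient (the measure is already normalized) *)
Definition fhat d (f : pt d -> R[i]) (k : freq d) : R[i] :=
  cint (fun x => f x * cexpm k x).

Definition ae_eq d (f g : pt d -> R[i]) : Prop :=
  almost_everywhere (@tmeas d) (fun x => f x = g x).

Definition ess_sup_t d (f : pt d -> R) : \bar R :=
  ereal_inf [set y | almost_everywhere (@tmeas d) (fun x => ((f x)%:E <= y)%E)].

Definition Fnorm2 d (w : freq d -> R) (f : pt d -> R[i]) : \bar R :=
  (\esum_(k in [set: freq d]) ((w k) ^+ 2 * (cabs (fhat f k)) ^+ 2)%:E)%E.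

Definition Fnorm d (w : freq d -> R) (f : pt d -> R[i]) : \bar R :=
  if (Fnorm2 w f < +oo)%E then (Num.sqrt (fine (Fnorm2 w f)))%:E else +oo%E.

Definition inF d (w : freq d -> R) (f : pt d -> R[i]) : Prop :=
  L1 f /\ (Fnorm2 w f < +oo)%E.

Definition Anorm d (f : pt d -> R[i]) : \bar R :=
  (\esum_(k in [set: freq d]) (cabs (fhat f k))%:E)%E.
Definition inA d (f : pt d -> R[i]) : Prop := L1 f /\ (Anorm f < +oo)%E.

Definition cont_per d (h : pt d -> R[i]) : Prop :=
  (forall x (e : R), 0 < e -> exists2 del : R, 0 < del &
     forall y : pt d, (forall i, `|tnth x i - tnth y i| < del) ->
       cabs (h x - h y) < e) /\
  (forall (x y : pt d), (forall i, exists m : int, tnth y i = tnth x i + m%:~R * (2 * pi)) ->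
       h x = h y).

(* C(T^d): functions (L_1 classes) having a continuous representative,
   normed by the sup norm of that representative *)
Definition inC d (f : pt d -> R[i]) : Prop :=
  L1 f /\ exists h, cont_per h /\ ae_eq f h.
Definition Cnorm d (f : pt d -> R[i]) : \bar R :=
  ereal_inf [set ereal_sup (range (fun x => (cabs (h x))%:E)) |
             h in [set h | cont_per h /\ ae_eq f h]].

Definition Linfnorm d (f : pt d -> R[i]) : \bar R := ess_sup_t (fun x => cabs (f x)).
Definition inLinf d (f : pt d -> R[i]) : Prop := L1 f /\ (Linfnorm f < +oo)%E.

Inductive Gspace := WienerA | ContC | Linfty.

Definition inG (G : Gspace) d : (pt d -> R[i]) -> Prop :=
  match G with WienerA => @inA d | ContC => @inC d | Linfty => @inLinf d end.
Definition Gnorm (G : Gspace) d : (pt d -> R[i]) -> \bar R :=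
  match G with WienerA => @Anorm d | ContC => @Cnorm d | Linfty => @Linfnorm d end.

(* bounded linear operators A : F_d(w) -> G of rank < n (acting on L_1-classes) *)
Definition admissible (G : Gspace) d (w : freq d -> R) (n : nat)
    (A : (pt d -> R[i]) -> (pt d -> R[i])) : Prop :=
  [/\ (forall f, inF w f -> inG G (A f)),
      (forall f g, inF w f -> inF w g -> ae_eq f g -> ae_eq (A f) (A g)),
      (forall f g (c : R[i]), inF w f -> inF w g ->
          ae_eq (A (fun x => f x + c * g x)) (fun x => A f x + c * A g x)),
      (exists M : R, forall f, inF w f -> (Gnorm G (A f) <= M%:E * Fnorm w f)%E) &
      (exists2 m : nat, (m < n)%N & exists gs : 'I_m -> pt d -> R[i],
          (forall i, inG G (gs i)) /\
          forall f, inF w f -> exists c : 'I_m -> R[i],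
            ae_eq (A f) (fun x => \sum_(i < m) c i * gs i x))].

Definition opnorm_IminusA (G : Gspace) d (w : freq d -> R)
    (A : (pt d -> R[i]) -> (pt d -> R[i])) : \bar R :=
  ereal_sup [set Gnorm G (fun x => f x - A f x) |
             f in [set f | inF w f /\ (Fnorm w f <= 1)%E]].

Definition approx_num (G : Gspace) d (w : freq d -> R) (n : nat) : \bar R :=
  ereal_inf [set opnorm_IminusA G w A | A in admissible G w n].

End Torus.

(* Main.v *)
Require Import Defs.
From HB Require Import structures.
From mathcomp Require Import all_boot all_order all_algebra.
From mathcomp Require Import all_classical all_reals all_analysis.
From mathcomp Require Import complex.
From mathcomp Require Import measurable_realfun ess_sup_inf spectral sesquilinear.
From mathcomp Require Import ring lra.
Import Order.TTheory GRing.Theory Num.Theory.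
Import numFieldNormedType.Exports ComplexField.Normc.
Local Open Scope classical_set_scope.
Local Open Scope ring_scope.

(* The norms satisfy [L_infty <= C <= A]: an integrable function is determined by
   its Fourier coefficients, so a function in the Wiener algebra is almost
   everywhere the sum of its Fourier series.  It is therefore enough to bound the
   error of the partial Fourier sums in the Wiener norm, which is Cauchy-Schwarz,
   and to bound every rank [< n] operator [A] from below in the [L_infty] norm.
   For the latter let [f_k = e^{ikx} / w k], an orthonormal basis of [F_d(w)], and
   [g_k = f_k - A f_k].  Applying [I - A] to the unit vectors [sum_k u_k f_k] shows
   [sum_k |g_k(x)|^2 <= ||I - A||^2] for almost every [x]; integrating, the matrix
   of Fourier coefficients of the [g_k] has squared Frobenius norm at most
   [||I - A||^2].  That matrix is the diagonal matrix of the [1 / w k] minus a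
   matrix of rank [< n], so its squared Frobenius norm is at least
   [sum_{j >= n} sigma_j^2]. *)

(** The torus has total mass 1, so an almost everywhere bound for [sum_k |g_k(x)|^2] is also a bound
    for the Hilbert-Schmidt norm of [I - A] into L_2. This is why a sup-type target space leads to a
    sum of squares: in the Hilbert-Schmidt norm the best approximation of rank [< n] leaves exactly
    the tail of the squared singular numbers. The obstacle is that values of [A] are known only up
    to null sets, and the null set on which the bound for [sum_k u_k g_k(x)] fails depends on [u].
    Only countably many [u] can be tested at a common point [x]; the bound for all of them must be
    recovered from these. Only finite sections are handled, with [N] basis functions and [N]
    frequencies, so the matrices are finite and [A] is expanded on finite combinations. The limit in
    [N] is taken at the very end, in a scalar inequality for the tail. *)

Set Implicit Arguments. Unset Strict Implicit. Unset Printing Implicit Defensive.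

(** * The normalized measure on the torus *)

Section torus_measure.
Variable R : realType.
Local Notation mu1 := (@mu1 R).

Lemma twopi_gt0 : 0 < 2 * pi :> R.
Proof. by rewrite mulr_gt0// pi_gt0. Qed.

Lemma per_intE : @per_int R = `[0, 2 * pi[%classic.
Proof. by apply/seteqP; split => x /=; rewrite in_itv. Qed.

Lemma measurable_per_int : measurable (@per_int R).
Proof. by rewrite per_intE; exact: measurable_itv. Qed.

Let mu1_0 : mu1 set0 = 0%E.
Proof. by rewrite /mu1 set0I measure0 mule0. Qed.

Let mu1_ge0 A : (0 <= mu1 A)%E.
Proof.
by apply: mule_ge0 => //; rewrite lee_fin invr_ge0 ltW// twopi_gt0.
Qed.

Let twopiV_ge0 : 0 <= (2 * pi)^-1 :> R.
Proof. by rewrite invr_ge0 ltW// twopi_gt0. Qed.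

Let mu1_sigma_additive : semi_sigma_additive mu1.
Proof.
exact: (@measure_semi_sigma_additive _ _ _
  (mscale (NngNum twopiV_ge0) (mrestr lebesgue_measure measurable_per_int))).
Qed.

HB.instance Definition _ := isMeasure.Build _ _ R mu1
  mu1_0 mu1_ge0 mu1_sigma_additive.

Let mu1_setT : mu1 [set: R] = 1%E.
Proof.
rewrite /mu1 setTI per_intE lebesgue_measure_itv/= lte_fin twopi_gt0.
by rewrite oppr0 addr0 -EFinM mulVf// gt_eqF// twopi_gt0.
Qed.

HB.instance Definition _ := Measure_isProbability.Build _ _ R mu1 mu1_setT.

Definition consp d (p : pt R d * R) : pt R d.+1 := [tuple of p.2 :: p.1].

Lemma measurable_consp d : measurable_fun setT (@consp d).
Proof. by apply: measurable_cons => //. Qed.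

Lemma tmeasS d : @tmeas R d.+1 = pushforward (@tmeas R d \x mu1)%E (@consp d).
Proof.
apply/funext => A; rewrite /tmeas -/tmeas /pushforward.
by congr (product_measure1 _ _ _); apply/seteqP; split=> p /=; rewrite inE.
Qed.


HB.instance Definition _ d :=
  isMeasurableFun.Build _ _ _ _ (@consp d) (@measurable_consp d).

(** The product in the recursive clause of [tmeas] is a measure only if its left factor is one. The
    induction therefore carries a packaged probability with the same underlying set function, from
    which the instances for [tmeas] itself are read off. *)
Lemma tmeas_is_probability d :
  {P : probability (pt R d) R | @tmeas R d = P :> (set _ -> \bar R)}.
Proof.
elim: d => [|d [P PE]].
  by exists (@dirac _ _ ([tuple] : 0.-tuple R) R).
exists (distribution (P \x mu1)%E (@consp d)).
by rewrite tmeasS PE.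
Qed.

Section instances.
Variable d : nat.

Let tmeas0 : @tmeas R d set0 = 0%E.
Proof. by have [P ->] := tmeas_is_probability d; exact: measure0. Qed.

Let tmeas_ge0 A : (0 <= @tmeas R d A)%E.
Proof. by have [P ->] := tmeas_is_probability d; exact: measure_ge0. Qed.

Let tmeas_sigma_additive : semi_sigma_additive (@tmeas R d).
Proof.
by have [P ->] := tmeas_is_probability d; exact: measure_semi_sigma_additive.
Qed.

HB.instance Definition _ := isMeasure.Build _ _ R (@tmeas R d)
  tmeas0 tmeas_ge0 tmeas_sigma_additive.

Let tmeas_setT : @tmeas R d [set: _] = 1%E.
Proof. by have [P ->] := tmeas_is_probability d; exact: probability_setT. Qed.

HB.instance Definition _ := Measure_isProbability.Build _ _ R (@tmeas R d)
  tmeas_setT.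
End instances.

Local Notation tm d := (@tmeas R d).

Lemma bounded_integrable d' (T : measurableType d')
    (mu : {finite_measure set T -> \bar R}) (f : T -> R) (M : R) :
  measurable_fun setT f -> (forall x, `|f x| <= M) ->
  mu.-integrable setT (EFin \o f).
Proof.
move=> mf fM; apply: (@le_integrable _ _ _ _ _ _ _ (cst M%:E)) => //.
- exact/measurable_EFinP.
- move=> x _ /=; rewrite lee_fin (le_trans (fM x))//.
  by rewrite ler_norm.
- by apply: finite_measure_integrable_cst.
Qed.

Lemma Rintegral_prob_prod d1 d2 (T1 : measurableType d1)
    (T2 : measurableType d2) (P1 : probability T1 R) (P2 : probability T2 R)
    (f : T1 * T2 -> R) (M : R) :
  measurable_fun setT f -> (forall x, `|f x| <= M) ->
  \int[(P1 \x P2)%E]_z f z = \int[P1]_x \int[P2]_y f (x, y).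
Proof.
move=> mf fM.
rewrite /Rintegral -integral12_prod_meas1//; last first.
  exact: (bounded_integrable (((P1 \x P2)%E : probability _ R)
    : {finite_measure set _ -> \bar R}) mf fM).
congr fine; apply: eq_integral => x _; rewrite /fubini_F fineK//.
apply: integrable_fin_num => //.
apply: (@bounded_integrable _ _ P2 (fun t => f (x, t)) M) => //.
exact: measurableT_comp mf (pair1_measurable x).
Qed.

Lemma Rintegral_tmeasS d (f : pt R d.+1 -> R) (M : R) :
  measurable_fun setT f -> (forall x, `|f x| <= M) ->
  \int[tm d.+1]_x f x = \int[tm d]_x \int[mu1]_t f (consp (x, t)).
Proof.
move=> mf fM.
have mfc : measurable_fun setT (f \o @consp d).
  exact: measurableT_comp mf (@measurable_consp d).
rewrite -(@Rintegral_prob_prod _ _ _ _ (tm d) mu1 (f \o @consp d) M mfc (fun x => fM (consp x))).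
have ifc := bounded_integrable (((tm d \x mu1)%E : probability _ R)
  : {finite_measure set _ -> \bar R}) mfc (fun x => fM (consp x)).
have mEf : measurable_fun setT (EFin \o f) by exact/measurable_EFinP.
rewrite /Rintegral; congr fine.
rewrite -[RHS](@integral_pushforward _ _ _ _ R (@consp d) (@measurable_consp d)
  _ setT _ mEf ifc measurableT).
by apply: eq_measure_integral => A _ _; exact: (congr1 (@^~ A) (tmeasS d)).
Qed.

(** * Integrals of the characters over the torus *)

Lemma sin_intD2pi (k : int) (x : R) : sin (x + k%:~R * (2 * pi)) = sin x.
Proof.
have h : 2 * pi = pi *+ 2 :> R by rewrite mulr2n mulrDl mul1r.
rewrite h; case: k => k.
  by rewrite -pmulrn mulr_natl; exact: (periodicn (@sinD2pi R)).
rewrite NegzE mulrNz mulNr -pmulrn mulr_natl.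
have := periodicn (@sinD2pi R) k.+1 (x - pi *+ 2 *+ k.+1).
by move=> /= <-; rewrite subrK.
Qed.

Lemma cos_intD2pi (k : int) (x : R) : cos (x + k%:~R * (2 * pi)) = cos x.
Proof.
by rewrite -sinDpihalf addrAC sin_intD2pi sinDpihalf.
Qed.

(* [R] and [measurableTypeR R] have the same measurable sets but are not
   convertible as measurable types; [idR] transports integrals between them. *)
Definition idR (x : measurableTypeR R) : R := x.

Lemma measurable_idR : measurable_fun setT idR.
Proof. by move=> _ Y mY; rewrite setTI. Qed.

(** The half-open period and the closed interval differ by the null point [2 * pi]. The closed form
    gives access to the integral formula of the uniform law, and from there to the fundamental
    theorem of calculus. *)
Lemma mu1_uniform (A : set R) : measurable A ->
  mu1 A = pushforward (uniform_prob twopi_gt0) idR A.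
Proof.
move=> mA; rewrite /pushforward /uniform_prob integral_uniform_pdf.
have -> : idR @^-1` A = A by [].
rewrite (eq_integral (cst ((2 * pi)^-1)%:E)); last first.
  move=> y /[!inE] -[_]; rewrite /= in_itv/= => yI.
  by rewrite /uniform_pdf yI subr0.
rewrite integral_cst; last by apply: measurableI.
congr (_ * _)%E; rewrite per_intE.
have -> : A `&` `[0, 2 * pi] = A `&` (`[0, 2 * pi[ `|` [set 2 * pi]).
  congr (_ `&` _); apply/esym; apply: setUitv1.
  by rewrite bnd_simp ltW ?twopi_gt0.
rewrite setIUr measureU0 //.
- by apply: measurableI.
- by apply: measurableI.
- apply: (@subset_measure0 _ (measurableTypeR R) R lebesgue_measure _ [set 2 * pi]) => //.
    by apply: measurableI.
  exact: lebesgue_measure_set1.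
Qed.

Lemma ge0_integral_mu1 (g : R -> \bar R) :
  measurable_fun setT g -> (forall x, 0 <= g x)%E ->
  (\int[mu1]_t g t =
   ((2 * pi)^-1)%R%:E * \int[lebesgue_measure]_(t in `[0%R, (2 * pi)%R]) g t)%E.
Proof.
move=> mg g0.
have -> : (\int[mu1]_t g t =
    \int[pushforward (uniform_prob twopi_gt0) idR]_t g t)%E.
  apply: eq_measure_integral; first exact: measurable_idR.
  by move=> ? A mA _; exact: mu1_uniform.
rewrite (ge0_integral_pushforward measurable_idR)//= integral_uniform//.
by rewrite subr0.
Qed.

Lemma Rintegral_mu1_cos (k : int) (th : R) : k != 0 ->
  \int[mu1]_t cos (th + k%:~R * t) = 0.
Proof.
move=> k0.
have kR0 : k%:~R != 0 :> R by rewrite intr_eq0.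
(* Adding 1 makes the integrand nonnegative, as [ge0_integral_mu1] demands; the constant is removed
   again at the end. [G] is a primitive of [g]. *)
pose g (t : R) := 1 + cos (th + k%:~R * t).
pose G (t : R) := t + sin (th + k%:~R * t) / k%:~R.
have dG t : is_derive t (1:R) G (g t).
  rewrite /G /g; apply: is_derive_eq.
  by rewrite /GRing.scale/=; field.
have cg : continuous g.
  move=> t; apply: cvgD; first exact: cvg_cst.
  apply: continuous_comp; last exact: continuous_cos.
  by apply: cvgD; [exact: cvg_cst|apply: cvgM; [exact: cvg_cst|exact: cvg_id]].
have mg : measurable_fun setT g by apply: continuous_measurable_fun.
have g0 t : 0 <= g t by rewrite -lerBlDl sub0r cos_geN1.
have intg : (\int[mu1]_t (g t)%:E = 1)%E.
  rewrite ge0_integral_mu1//.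
    rewrite (@continuous_FTC2 _ g G)//.
    - rewrite /G [_ * (2 * pi)]mulrC -[in X in sin X]mulrC sin_intD2pi mulr0 addr0.
      rewrite -EFinB -EFinM add0r addrK mulVf//.
      by rewrite gt_eqF// twopi_gt0.
    - exact: twopi_gt0.
    - exact: continuous_subspaceT.
    - have cG : continuous G.
        move=> t; apply: differentiable_continuous.
        by apply/derivable1_diffP; have [] := dG t.
      split.
      + by move=> t _; have [] := dG t.
      + exact: cvg_at_right_filter (cG _).
      + exact: cvg_at_left_filter (cG _).
    - by move=> t _; rewrite derive1E; have [_ <-] := dG t.
  - exact/measurable_EFinP.
have : \int[mu1]_t g t = 1 by rewrite /Rintegral intg.
have mc : measurable_fun setT (fun t : R => cos (th + k%:~R * t)).
  have -> : (fun t => cos (th + k%:~R * t)) = g \- cst 1.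
    by apply/funext => t; rewrite /g /=; ring.
  exact: measurable_funB.
have ic := bounded_integrable mu1 mc (fun t => cos_max _).
rewrite /g RintegralD//=; last exact: finite_measure_integrable_cst.
rewrite Rintegral_cst// [X in fine X]mu1_setT mulr1 => /eqP.
by rewrite addrC -subr_eq0 addrK => /eqP.
Qed.

Lemma Rintegral_prob_cst d' (T : measurableType d') (P : probability T R)
  (c : R) : \int[P]_x c = c.
Proof. by rewrite Rintegral_cst// [X in fine X]probability_setT mulr1. Qed.

Lemma measurable_dotkx d (k : freq d) : measurable_fun setT (@dotkx R d k).
Proof.
apply: measurable_sum => i; apply: measurable_funM => //.
exact: measurable_tnth.
Qed.

Lemma measurable_cos_dotkx d (k : freq d) th :
  measurable_fun setT (fun x : pt R d => cos (th + dotkx k x)).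
Proof.
apply: (measurableT_comp (f := @cos R)).
  by apply: continuous_measurable_fun; exact: continuous_cos.
by apply: measurable_funD => //; exact: measurable_dotkx.
Qed.

Lemma dotkx_consp d (k : freq d.+1) (x : pt R d) (t : R) :
  dotkx k (consp (x, t)) =
  (thead k)%:~R * t + dotkx [tuple of behead k] x.
Proof.
rewrite /dotkx big_ord_recl; congr (_ * _ + _).
apply: eq_bigr => i _; rewrite tnthS; congr (_%:~R * _).
by rewrite [in LHS](tuple_eta k) tnthS.
Qed.

(** The free phase [th] absorbs the other coordinates: if the first entry of [k] is nonzero, already
    the inner integral vanishes, with phase [th + dotkx (behead k) x]. Otherwise the integrand does
    not depend on the first coordinate and the induction applies. Phases also cover the sine. *)
Lemma Rintegral_cos_dotkx d (k : freq d) (th : R) : k != [tuple 0 | _ < d] ->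
  \int[tm d]_x cos (th + dotkx k x) = 0.
Proof.
elim: d k th => [k|d IH k th k0]; first by rewrite [k]tuple0 [X in _ != X]tuple0 eqxx.
rewrite (@Rintegral_tmeasS _ _ 1); last 2 first.
- exact: measurable_cos_dotkx.
- by move=> x; exact: cos_max.
have [h0|h0] := eqVneq (thead k) 0; last first.
  rewrite -[RHS](Rintegral_prob_cst (tm d)).
  apply: eq_Rintegral => x _.
  rewrite -[RHS](Rintegral_mu1_cos (th + dotkx [tuple of behead k] x) h0).
  by apply: eq_Rintegral => t _; rewrite dotkx_consp addrA addrAC.
rewrite -[RHS](IH [tuple of behead k] th); last first.
  apply: contra k0 => /eqP kE; apply/eqP/eq_from_tnth => i.
  rewrite tnth_mktuple; have [j ->|->] := fintype.unliftP ord0 i => //.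
  have := congr1 (fun u => tnth u j) kE; rewrite /= tnth_mktuple => <-.
  by rewrite [in LHS](tuple_eta k) tnthS.
apply: eq_Rintegral => x _.
rewrite -[RHS](Rintegral_prob_cst mu1).
by apply: eq_Rintegral => t _; rewrite dotkx_consp h0 mul0r add0r.
Qed.

Lemma Rintegral_tnth d (i : 'I_d) (g : R -> R) (M : R) :
  measurable_fun setT g -> (forall t, `|g t| <= M) ->
  \int[tm d]_x g (tnth x i) = \int[mu1]_t g t.
Proof.
move=> mg gM; elim: d i => [[]//|d IH i].
rewrite (@Rintegral_tmeasS _ _ M) => [||x]; last exact: gM.
- have [j ->|->] := fintype.unliftP ord0 i.
    rewrite -(IH j); apply: eq_Rintegral => x _.
    rewrite -[RHS](Rintegral_prob_cst mu1).
    by apply: eq_Rintegral => t _; rewrite tnthS.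
  exact: Rintegral_prob_cst (tm d) (\int[mu1]_t g t).
- by apply: measurableT_comp => //; exact: measurable_tnth.
Qed.

Lemma tmeas_per_int d (i : 'I_d) :
  tm d [set x | ~ per_int (tnth x i)] = 0%E.
Proof.
have mA : measurable (~` @per_int R) by apply: measurableC; exact: measurable_per_int.
have mB : measurable [set x : pt R d | ~ per_int (tnth x i)].
  by have := @measurable_tnth _ R d i measurableT _ mA; rewrite setTI.
have mg : measurable_fun setT (\1_(~` @per_int R) : R -> R).
  exact: measurable_indic.
have g1 t : `|\1_(~` @per_int R) t : R| <= 1.
  by rewrite indicE; case: (_ \in _); rewrite ?normr1 ?normr0.
have := Rintegral_tnth i mg g1.
rewrite /Rintegral (_ : (fun x : pt R d => _) = fun x : pt R d =>
  (\1_[set x : pt R d | ~ per_int (tnth x i)] x)%:E); last first.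
  by apply/funext => x; rewrite !indicE.
rewrite !integral_indic// !setIT.
have h0 : mu1 (~` @per_int R) = 0%E by rewrite /mu1 setICl measure0 mule0.
rewrite [X in _ = fine X -> _]h0.
move=> hB; have /fineK <- : tm d [set x | ~ per_int (tnth x i)] \is a fin_num.
  exact: fin_num_measure.
exact: (congr1 EFin hB).
Qed.
End torus_measure.

(** * Uniqueness of Fourier coefficients *)

Section smoothstep.
Variable R : realType.

(* [smoothstep] preserves [0, 1] and fixes 0, 1/2 and 1; its iterates converge to
   the step function at 1/2. *)
Definition smoothstep (u : R) : R := 3 * u ^+ 2 - 2 * u ^+ 3.

Lemma smoothstep_itv u : 0 <= u <= 1 -> 0 <= smoothstep u <= 1.
Proof.
move=> /andP[u0 u1]; rewrite /smoothstep.
have u2 : 0 <= u ^+ 2 by exact: sqr_ge0.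
have v2 : 0 <= (1 - u) ^+ 2 by exact: sqr_ge0.
apply/andP; split.
  have -> : 3 * u ^+ 2 - 2 * u ^+ 3 = u ^+ 2 * (3 - 2 * u) by ring.
  by rewrite mulr_ge0//; lra.
rewrite -subr_ge0.
have -> : 1 - (3 * u ^+ 2 - 2 * u ^+ 3) = (1 - u) ^+ 2 * (1 + 2 * u) by ring.
by rewrite mulr_ge0//; lra.
Qed.

Lemma iter_smoothstep_itv n u : 0 <= u <= 1 -> 0 <= iter n smoothstep u <= 1.
Proof. by move=> u01; elim: n => [|n IH] //=; exact: smoothstep_itv. Qed.

Lemma iter_smoothstepC n u : iter n smoothstep (1 - u) = 1 - iter n smoothstep u.
Proof. by elim: n => [//|n /= ->]; rewrite /smoothstep; ring. Qed.

Lemma iter_smoothstep_half n : iter n smoothstep 2^-1 = 2^-1.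
Proof. by elim: n => [//|n /= ->]; rewrite /smoothstep; field. Qed.

(** From [1 - smoothstep v = (1 - v) * (1 - v * (2 * v - 1))], each step shrinks the distance to 1
    by a factor at most [q], its value at the starting point, because the iterates never drop below
    [u > 1/2]. Convergence is geometric. *)
Lemma cvg_iter_smoothstep1 u : 2^-1 < u -> u <= 1 ->
  (fun n => iter n smoothstep u) @ \oo --> (1 : R).
Proof.
move=> u2 u1; pose q := 1 - u * (2 * u - 1).
have q0 : 0 <= q by rewrite /q; nra.
have q1 : q < 1 by rewrite /q; nra.
have H n : u <= iter n smoothstep u <= 1 /\ 1 - iter n smoothstep u <= q ^+ n.
  elim: n => [|n [/andP[IH1 IH2] IH3]] /=; first by rewrite lexx expr0; split => //; lra.
  set v := iter n smoothstep u in IH1 IH2 IH3 *.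
  have E : 1 - smoothstep v = (1 - v) * (1 - v * (2 * v - 1)).
    by rewrite /smoothstep; ring.
  have qv : 1 - v * (2 * v - 1) <= q by rewrite /q; nra.
  have qv0 : 0 <= 1 - v * (2 * v - 1) by nra.
  have v1 : 0 <= 1 - v by lra.
  split.
    have : 1 - smoothstep v <= 1 - v by rewrite E ler_piMr// (le_trans qv)// ltW.
    have : 0 <= 1 - smoothstep v by rewrite E mulr_ge0.
    move=> ? ?; apply/andP; split; lra.
  by rewrite E exprSr ler_pM.
have h1 : (fun n => 1 - q ^+ n) @ \oo --> (1 - 0 : R).
  apply: cvgB; first exact: cvg_cst.
  by apply: cvg_expr; rewrite ger0_norm.
rewrite subr0 in h1.
apply: (squeeze_cvgr _ h1 (cvg_cst (1:R))).
apply: nearW => n; have [/andP[_ ->] Hn] := H n.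
by rewrite andbT lerBlDr addrC -lerBlDr.
Qed.

Lemma cvg_iter_smoothstep u : 0 <= u <= 1 ->
  (fun n => iter n smoothstep u) @ \oo -->
  (if 2^-1 < u then 1 else if u == 2^-1 then 2^-1 else 0 : R).
Proof.
move=> /andP[u0 u1]; case: ifPn => [u2|]; first exact: cvg_iter_smoothstep1.
rewrite -leNgt => u2; case: ifPn => [/eqP ->|un].
  by under eq_fun do rewrite iter_smoothstep_half; exact: cvg_cst.
(* The symmetry about 1/2 reduces [u < 1/2] to the case above. *)
have -> : (fun n => iter n smoothstep u) = (fun n => 1 - iter n smoothstep (1 - u)).
  by apply/funext => n; rewrite iter_smoothstepC; ring.
rewrite -[X in _ --> X](subrr (1 : R)).
apply: cvgB; first exact: cvg_cst.
have : u < 2^-1 by rewrite lt_neqAle un.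
by move=> ?; apply: cvg_iter_smoothstep1; lra.
Qed.

End smoothstep.

Section uniqueness.
Variables (R : realType) (d : nat).
Local Notation T := (pt R d).
Local Notation mu := (@tmeas R d).

Lemma integrable_mul_bounded (h g : T -> R) (M : R) :
  mu.-integrable setT (EFin \o h) -> measurable_fun setT g ->
  (forall x, `|g x| <= M) -> mu.-integrable setT (EFin \o (fun x => h x * g x)).
Proof.
move=> ih mg gM.
have mh : measurable_fun setT h by apply/measurable_EFinP; exact: (measurable_int mu).
apply: (@le_integrable _ _ _ mu setT measurableT _ (fun x => (M * h x)%:E)).
- by apply/measurable_EFinP; exact: measurable_funM.
- move=> x _ /=; rewrite lee_fin !normrM mulrC ler_wpM2r//.
  exact: le_trans (gM x) (ler_norm _).
- exact: (@integrableZl _ _ _ mu setT measurableT M (EFin \o h) ih).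
Qed.

(* The multipliers of the space of functions with vanishing Fourier coefficients
   form an algebra, stable under bounded pointwise limits, that contains the
   trigonometric polynomials.  Hence the sets with multiplier indicator form a
   sigma-algebra; it contains all Borel sets, so a function with vanishing
   coefficients integrates to 0 over every Borel set. *)
Definition null_coeffs (h : T -> R) :=
  mu.-integrable setT (EFin \o h) /\
  forall k th, \int[mu]_x (h x * cos (th + dotkx k x)) = 0.

Definition multiplier (g : T -> R) :=
  [/\ measurable_fun setT g, exists M, forall x, `|g x| <= M &
      forall h, null_coeffs h -> null_coeffs (fun x => h x * g x)].

Lemma multiplier_cst (c : R) : multiplier (cst c).
Proof.
split => //; first by exists `|c|.
move=> h [ih h0]; split.
  by apply: (@integrable_mul_bounded h (cst c) `|c|).
move=> k th; rewrite -[RHS](mulr0 c) -(h0 k th).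
rewrite -RintegralZl//; last first.
  apply: (integrable_mul_bounded ih (M := 1)) => [|x]; last exact: cos_max.
  exact: measurable_cos_dotkx.
by apply: eq_Rintegral => x _ /=; ring.
Qed.

Lemma multiplierD f g : multiplier f -> multiplier g -> multiplier (f \+ g).
Proof.
move=> [mf [M fM] Nf] [mg [M' gM] Ng]; split.
- exact: measurable_funD.
- by exists (M + M') => x; rewrite (le_trans (ler_normD _ _))// lerD.
move=> h Nh; have [ihf hf0] := Nf h Nh; have [ihg hg0] := Ng h Nh.
have [ih _] := Nh; split.
  apply: (@integrable_mul_bounded h (f \+ g) (M + M')) => //.
    exact: measurable_funD.
  by move=> x; rewrite (le_trans (ler_normD _ _))// lerD.
have ic h' k th : mu.-integrable setT (EFin \o h') ->
    mu.-integrable setT (EFin \o (fun x => h' x * cos (th + dotkx k x))).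
  move=> ih'; apply: (integrable_mul_bounded ih' (M := 1)) => [|x]; last exact: cos_max.
  exact: measurable_cos_dotkx.
move=> k th; rewrite -[RHS](addr0 0) -{1}(hf0 k th) -(hg0 k th).
rewrite -RintegralD//; [|exact: ic|exact: ic].
by apply: eq_Rintegral => x _ /=; ring.
Qed.

Lemma multiplierM f g : multiplier f -> multiplier g -> multiplier (f \* g).
Proof.
move=> [mf [M fM] Nf] [mg [M' gM] Ng]; split.
- exact: measurable_funM.
- by exists (M * M') => x; rewrite normrM ler_pM.
move=> h Nh; have := Ng _ (Nf _ Nh).
by under eq_fun do rewrite -mulrA.
Qed.

Lemma multiplierX f n : multiplier f -> multiplier (fun x => f x ^+ n).
Proof.
move=> mf; elim: n => [|n IH]; first exact: multiplier_cst.
by under eq_fun do rewrite exprS; exact: multiplierM.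
Qed.

Lemma multiplier_lim (g_ : nat -> T -> R) (g : T -> R) (M : R) :
  (forall n, multiplier (g_ n)) -> (forall n x, `|g_ n x| <= M) ->
  (forall x, g_ ^~ x @ \oo --> g x) -> multiplier g.
Proof.
move=> mg_ g_M g_g.
have mg : measurable_fun setT g.
  by apply: (measurable_fun_cvg (h := g_)) => // m; have [] := mg_ m.
have gM x : `|g x| <= M.
  have h : (fun n => `|g_ n x|) @ \oo --> `|g x| by apply: cvg_norm; exact: g_g.
  by apply: (ler_cvg_to h (cvg_cst M)); apply: nearW => n; exact: g_M.
split => //; first by exists M.
move=> h Nh; have [ih h0] := Nh.
split; first exact: integrable_mul_bounded ih mg gM.
move=> k th.
have mc := @measurable_cos_dotkx R d k th.
have mh : measurable_fun setT h by apply/measurable_EFinP; exact: (measurable_int mu).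
have [] := @dominated_convergence _ _ _ mu setT measurableT
  (fun n x => (h x * g_ n x * cos (th + dotkx k x))%:E)
  (fun x => (h x * g x * cos (th + dotkx k x))%:E)
  (fun x => (M * `|h x|)%:E).
- move=> n; apply/measurable_EFinP; apply: measurable_funM => //.
  by apply: measurable_funM => //; have [] := mg_ n.
- by apply/measurable_EFinP; apply: measurable_funM => //; exact: measurable_funM.
- apply: aeW => x _; apply: cvg_EFin; first exact: nearW.
  apply: cvgM; last exact: cvg_cst.
  by apply: cvgM; [exact: cvg_cst|exact: g_g].
- apply: (@integrableZl _ _ _ mu setT measurableT M (fun x => `|h x|%:E)).
  exact: (integrable_abse ih).
- apply: aeW => x n _; rewrite lee_fin !normrM -mulrA [leRHS]mulrC.
  by rewrite ler_wpM2l// -[leRHS]mulr1 ler_pM// cos_max.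
move=> ihg _ h1.
have : [sequence (\int[mu]_x (h x * g_ n x * cos (th + dotkx k x))%:E)%E]_n @ \oo --> 0%E.
  rewrite (_ : (fun n => _) = cst 0%E); first exact: cvg_cst.
  apply/funext => n; have [_ _ /(_ h Nh) [ihn hn]] := mg_ n.
  rewrite -(fineK (x := (\int[mu]_x _)%E)).
    by have := hn k th; rewrite /Rintegral => ->.
  apply: integrable_fin_num => //.
  apply: (integrable_mul_bounded ihn mc (M := 1)) => x; exact: cos_max.
move=> h2; rewrite /Rintegral.
by have -> := cvg_unique _ h1 h2.
Qed.

Lemma multiplier_cos (i : 'I_d) (th' : R) :
  multiplier (fun x => cos (th' + tnth x i)).
Proof.
have mc : measurable_fun setT (fun x : T => cos (th' + tnth x i)).
  apply: (measurableT_comp (f := @cos R)).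
    by apply: continuous_measurable_fun; exact: continuous_cos.
  by apply: measurable_funD => //; exact: measurable_tnth.
split => //; first by exists 1 => x; exact: cos_max.
move=> h [ih h0]; split.
  by apply: (integrable_mul_bounded ih mc) => x; exact: cos_max.
move=> k th.
(* [k1] and [k2] are [k] plus and minus the [i]-th unit vector. The formula [cos A * cos B = (cos (A
   + B) + cos (A - B)) / 2] turns the product into cosines with these frequencies and shifted
   phases, which is why [null_coeffs] quantifies over all phases. *)
pose k1 : freq d := [tuple tnth k j + (j == i)%:Z | j < d].
pose k2 : freq d := [tuple tnth k j - (j == i)%:Z | j < d].
have E1 (x : T) : dotkx k1 x = dotkx k x + tnth x i.
  rewrite /dotkx [in RHS](_ : tnth x i = \sum_(j < d) ((j == i)%:Z)%:~R * tnth x j).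
    rewrite -big_split/=; apply: eq_bigr => j _.
    by rewrite tnth_mktuple rmorphD/= mulrDl.
  rewrite (bigD1 i)//= eqxx mul1r big1 ?addr0// => j /negbTE ->.
  by rewrite mul0r.
have E2 (x : T) : dotkx k2 x = dotkx k x - tnth x i.
  rewrite /dotkx [in RHS](_ : tnth x i = \sum_(j < d) ((j == i)%:Z)%:~R * tnth x j).
    rewrite -sumrB/=; apply: eq_bigr => j _.
    by rewrite tnth_mktuple rmorphB/= mulrBl.
  rewrite (bigD1 i)//= eqxx mul1r big1 ?addr0// => j /negbTE ->.
  by rewrite mul0r.
have ic k' a : mu.-integrable setT (EFin \o (fun x => h x * cos (a + dotkx k' x))).
  apply: (integrable_mul_bounded ih (M := 1)) => [|x]; last exact: cos_max.
  exact: measurable_cos_dotkx.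
have Z : \int[mu]_x (h x * cos ((th + th') + dotkx k1 x)
  + h x * cos ((th - th') + dotkx k2 x)) = 0.
  by rewrite RintegralD ?h0 ?addr0//; exact: ic.
rewrite -[RHS](mulr0 2^-1) -Z -RintegralZl//; last first.
  exact: (@integrableD _ _ _ mu setT measurableT _ _ (ic k1 _) (ic k2 _)).
apply: eq_Rintegral => x _ /=; rewrite E1 E2.
have -> : th + th' + (dotkx k x + tnth x i) = (th + dotkx k x) + (th' + tnth x i) by ring.
have -> : th - th' + (dotkx k x - tnth x i) = (th + dotkx k x) - (th' + tnth x i) by ring.
set A := th + dotkx k x; set B := th' + tnth x i.
by rewrite (cosB A B) (cosD A B); field.
Qed.

(** * The sigma-algebra of sets with multiplier indicator *)

Definition multiplier_set : set (set T) :=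
  [set B | multiplier (\1_B : T -> R)].

(* Iterating [smoothstep] on an affine image of [s] yields the multiplier [g] equal
   to 1, 1/2, 0 where [s > c], [s = c], [s < c], and [2 g ^ 2 - g] is the
   indicator of [s > c]. *)
Lemma multiplier_gt (s : T -> R) (c : R) : (forall x, `|s x| <= 1) ->
  `|c| <= 1 -> multiplier s -> multiplier_set [set x | c < s x].
Proof.
move=> s1 c1 ms.
(* Since [|s x - c| <= 2], the factor 1/4 keeps the starting value in [0, 1], and the threshold
   [s x = c] lands on the fixed point 1/2. *)
pose u n x := iter n (@smoothstep R) (2^-1 + (s x - c) / 4).
have u01 x : 0 <= 2^-1 + (s x - c) / 4 <= 1.
  move: (s1 x) c1; rewrite !ler_norml => /andP[? ?] /andP[? ?].
  by apply/andP; split; lra.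
pose g x : R := if c < s x then 1 else if s x == c then 2^-1 else 0.
have mu_ n : multiplier (u n).
  elim: n => [|n IH]; rewrite /u.
    have -> : (fun x => iter 0 (@smoothstep R) (2^-1 + (s x - c) / 4)) =
        (s \* cst (4^-1)) \+ cst (2^-1 - c / 4).
      by apply/funext => x /=; field.
    apply: multiplierD; last exact: multiplier_cst.
    by apply: multiplierM => //; exact: multiplier_cst.
  have -> : (fun x => iter n.+1 (@smoothstep R) (2^-1 + (s x - c) / 4)) =
      (cst 3 \* (fun x => u n x ^+ 2)) \+ (cst (- 2) \* (fun x => u n x ^+ 3)).
    by apply/funext => x /=; rewrite {1}/smoothstep -/(u n x); ring.
  apply: multiplierD; apply: multiplierM; try exact: multiplier_cst.
  - exact: (multiplierX 2 IH).
  - exact: (multiplierX 3 IH).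
have mg : multiplier g.
  apply: (multiplier_lim (M := 1) mu_) => [n x|x].
    have /andP[? ?] := iter_smoothstep_itv n (u01 x).
    by rewrite ger0_norm.
  have := cvg_iter_smoothstep (u01 x).
  rewrite ltrDl -[in X in X -> _](inj_eq (addrI (- 2^-1))) addKr addNr.
  by rewrite mulf_eq0 invr_eq0 pnatr_eq0 orbF subr_eq0 pmulr_lgt0 ?invr_gt0// subr_gt0.
rewrite /multiplier_set /=.
have -> : (\1_[set x | c < s x] : T -> R) =
    (cst 2 \* (fun x => g x ^+ 2)) \+ (cst (- 1) \* g).
  apply/funext => x /=; rewrite indicE /g; case: ifPn => cs.
    by rewrite mem_set//=; ring.
  rewrite memNset/=; last exact/negP.
  by case: ifPn => _ /=; field.
apply: multiplierD; apply: multiplierM => //; try exact: multiplier_cst.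
exact: (multiplierX 2 mg).
Qed.

Lemma multiplier_setC A : multiplier_set A -> multiplier_set (~` A).
Proof.
move=> mA; rewrite /multiplier_set /=.
have -> : (\1_(~` A) : T -> R) = cst 1 \+ (cst (- 1) \* \1_A).
  by apply/funext => x /=; rewrite !indicE in_setC; case: (x \in A) => /=; ring.
apply: multiplierD; first exact: multiplier_cst.
by apply: multiplierM => //; exact: multiplier_cst.
Qed.

Lemma multiplier_set0 : multiplier_set set0.
Proof. by rewrite /multiplier_set /= indic0; exact: multiplier_cst. Qed.

Lemma multiplier_setU A B : multiplier_set A -> multiplier_set B ->
  multiplier_set (A `|` B).
Proof.
move=> mA mB; rewrite /multiplier_set /=.
have -> : (\1_(A `|` B) : T -> R) = (\1_A \+ \1_B) \+ (cst (- 1) \* (\1_A \* \1_B)).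
  apply/funext => x /=; rewrite !indicE in_setU.
  by case: (x \in A); case: (x \in B) => /=; ring.
apply: multiplierD; first exact: multiplierD.
apply: multiplierM; first exact: multiplier_cst.
exact: multiplierM.
Qed.

(** At each point the indicators of the finite unions are eventually constant, so [multiplier_lim]
    applies. *)
Lemma multiplier_set_bigcup (F : nat -> set T) :
  (forall n, multiplier_set (F n)) -> multiplier_set (\bigcup_n F n).
Proof.
move=> mF.
have mG n : multiplier_set (\big[setU/set0]_(i < n) F i).
  elim: n => [|n IH]; first by rewrite big_ord0; exact: multiplier_set0.
  by rewrite big_ord_recr; exact: multiplier_setU.
apply: (multiplier_lim (M := 1) mG) => [n x|x].
  by rewrite indicE; case: (_ \in _); rewrite ?normr1 ?normr0.
apply: cvg_near_cst.
have [[n _ Fnx]|nF] := pselect ((\bigcup_n F n) x).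
  exists n.+1 => // m /= nm; rewrite !indicE.
  by rewrite !mem_set//; [exists n|rewrite -bigcup_mkord; exists n].
apply: nearW => m; rewrite !indicE !memNset//.
by rewrite -bigcup_mkord => -[i _ Fix]; apply: nF; exists i.
Qed.

Lemma sigma_algebra_multiplier : sigma_algebra setT multiplier_set.
Proof.
split; [exact: multiplier_set0| |exact: multiplier_set_bigcup].
by move=> A mA; rewrite setTD; exact: multiplier_setC.
Qed.

Lemma ae_per_int : {ae mu, forall x, forall i, per_int (tnth x i)}.
Proof.
apply: filter_forall => i; exists [set x | ~ per_int (tnth x i)].
split => //; last exact: tmeas_per_int.
have mA : measurable (~` @per_int R) by apply: measurableC; exact: measurable_per_int.
by have := @measurable_tnth _ R d i measurableT _ mA; rewrite setTI.
Qed.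

(** Needed because half-spaces are not periodic: they agree with sets described by sines and cosines
    only on the cube, which carries all the mass. *)
Lemma multiplier_set_ae (A B : set T) : measurable A -> multiplier_set B ->
  {ae mu, forall x, A x <-> B x} -> multiplier_set A.
Proof.
move=> mA [mB _ NB] AB; split.
- exact: measurable_indic.
- by exists 1 => x; rewrite indicE; case: (_ \in _); rewrite ?normr1 ?normr0.
move=> h Nh; have [ih _] := Nh; have [ihB hB0] := NB _ Nh.
have ihA : mu.-integrable setT (EFin \o (fun x => h x * \1_A x)).
  apply: (integrable_mul_bounded ih (M := 1)); first exact: measurable_indic.
  by move=> x; rewrite indicE; case: (_ \in _); rewrite ?normr1 ?normr0.
split => // k th; rewrite -(hB0 k th) /Rintegral; congr fine.
have mc := @measurable_cos_dotkx R d k th.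
apply: ae_eq_integral => //.
- apply: (measurable_int mu); apply: (integrable_mul_bounded ihA mc (M := 1)) => x; exact: cos_max.
- apply: (measurable_int mu); apply: (integrable_mul_bounded ihB mc (M := 1)) => x; exact: cos_max.
apply: filterS AB => x /= AB _; rewrite !indicE; congr ((_ * _ * _)%:E).
by congr (_%:R); congr nat_of_bool; apply/idP/idP; rewrite !inE => /AB.
Qed.

Lemma multiplier_cos_gt (i : 'I_d) (th c : R) : `|c| <= 1 ->
  multiplier_set [set x | c < cos (th + tnth x i)].
Proof.
by move=> c1; apply: multiplier_gt => //; [move=> x; exact: cos_max|exact: multiplier_cos].
Qed.

(** The cosine is monotone only on each half of the period; the sign of the sine tells which half
    contains [x]. On the first half it decreases, and for [a > pi] the companion lemma uses that it
    increases on the second. *)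
Lemma lt_sin_cos (a x : R) : 0 < a <= pi -> 0 <= x < 2 * pi ->
  x < a <-> 0 <= sin x /\ cos a < cos x.
Proof.
move=> /andP[a0 api] /andP[x0 x2].
have aI : a \in `[0, pi] by rewrite in_itv/= api ltW.
split=> [xa|[sx cx]].
  have xpi : x <= pi by rewrite (le_trans (ltW xa)).
  split; first by rewrite sin_ge0_pi// x0.
  by rewrite ltr_cos// in_itv/= x0.
have [xpi|xpi] := leP x pi.
  by rewrite -ltr_cos// in_itv/= x0.
have : 0 < sin (x - pi) by rewrite sin_gt0_pi//; lra.
by have := @sinDpi R (x - pi); rewrite subrK => E; rewrite E in sx; lra.
Qed.

Lemma lt_sin_cos_gt_pi (a x : R) : pi < a <= 2 * pi -> 0 <= x < 2 * pi ->
  x < a <-> 0 <= sin x \/ cos x < cos a.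
Proof.
move=> /andP[a0 api] /andP[x0 x2].
have cosE y : cos y = cos (2 * pi - y) :> R.
  by rewrite -[RHS]cosN opprB; have := cos_intD2pi 1 (y - 2 * pi); rewrite mul1r subrK.
have main : pi < x -> (cos x < cos a) = (x < a).
  move=> xpi; rewrite [cos x]cosE [cos a]cosE ltr_cos ?in_itv/=.
  - by rewrite ltrD2l ltrN2.
  - by apply/andP; split; lra.
  - by apply/andP; split; lra.
have [xpi|xpi] := leP x pi.
  have xa : x < a by lra.
  by split => // _; left; rewrite sin_ge0_pi// x0.
rewrite -(main xpi); split; first by right.
case => // sx.
have : 0 < sin (x - pi) by rewrite sin_gt0_pi//; lra.
by have := @sinDpi R (x - pi); rewrite subrK => E; rewrite E in sx; lra.
Qed.

Lemma multiplier_set_lt (i : 'I_d) (a : R) : multiplier_set [set x | tnth x i < a].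
Proof.
have mA : measurable [set x : T | tnth x i < a].
  rewrite (_ : [set x : T | _] = (fun x : T => tnth x i) @^-1` `]-oo, a[%classic).
    by have := @measurable_tnth _ R d i measurableT _ (measurable_itv `]-oo, a[); rewrite setTI.
  by apply/seteqP; split => x /=; rewrite in_itv.
have msin : multiplier_set [set x | 0 <= sin (tnth x i)].
  (* Only superlevel sets of shifted cosines are available so far; [cos (pi / 2 + t) = - sin t]
     makes this set the complement of one. *)
  have -> : [set x : T | 0 <= sin (tnth x i)] = ~` [set x | 0 < cos (pi / 2 + tnth x i)].
    apply/seteqP; split => x /=; rewrite addrC cosDpihalf oppr_gt0 leNgt; first by move/negP.
    by move=> ?; apply/negP.
  by apply/multiplier_setC/multiplier_cos_gt; rewrite normr0.
have [a0|a0] := leP a 0.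
  apply: multiplier_set_ae mA multiplier_set0 _.
  apply: filterS ae_per_int => x /(_ i) /andP[x0 _]; split => //= xa.
  by have := lt_le_trans xa (le_trans a0 x0); rewrite ltxx.
have [a2|a2] := leP a (2 * pi); last first.
  have mT : multiplier_set setT by rewrite -setC0; exact/multiplier_setC/multiplier_set0.
  apply: multiplier_set_ae mA mT _.
  apply: filterS ae_per_int => x /(_ i) /andP[_ x2]; split => //= _.
  exact: lt_trans x2 a2.
have [api|api] := leP a pi.
  have mB : multiplier_set (~` (~` [set x | 0 <= sin (tnth x i)] `|`
      ~` [set x | cos a < cos (0 + tnth x i)])).
    apply/multiplier_setC/multiplier_setU; apply: multiplier_setC => //.
    exact/multiplier_cos_gt/cos_max.
  rewrite setCU !setCK in mB.
  apply: multiplier_set_ae mA mB _.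
  apply: filterS ae_per_int => x /(_ i) xI /=; rewrite add0r.
  by apply: lt_sin_cos => //; rewrite a0.
(* Since [cos (pi + t) = - cos t], the second set is the sublevel set [cos t < cos a] written as a
   superlevel set. *)
have mB : multiplier_set ([set x | 0 <= sin (tnth x i)] `|`
      [set x | - cos a < cos (pi + tnth x i)]).
  by apply: multiplier_setU => //; apply: multiplier_cos_gt; rewrite normrN cos_max.
apply: multiplier_set_ae mA mB _.
apply: filterS ae_per_int => x /(_ i) xI /=.
by rewrite addrC cosDpi ltrN2; apply: lt_sin_cos_gt_pi => //; rewrite api.
Qed.

(** Good sets in two stages: the sigma-algebra of tuples is generated by preimages of Borel sets
    under the coordinates, and the Borel sets of the line by the rays []-oo, a[]. *)
Lemma measurable_multiplier (A : set T) : measurable A -> multiplier_set A.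
Proof.
move: A; apply: smallest_sub; first exact: sigma_algebra_multiplier.
apply: (big_ind (fun S : set (set T) => S `<=` multiplier_set)) => // [S1 S2 h1 h2|].
  by move=> A [/h1|/h2].
move=> i _ _ [B mB <-]; rewrite setTI.
have : sigma_algebra setT [set B : set R | multiplier_set ((@tnth d R)^~ i @^-1` B)].
  split => /=.
  - by rewrite preimage_set0; exact: multiplier_set0.
  - by move=> C mC; rewrite setTD preimage_setC; exact: multiplier_setC.
  - by move=> F mF; rewrite preimage_bigcup; exact: multiplier_set_bigcup.
move=> sB; move: B mB; rewrite [measurable](RGenInftyO.measurableE R).
apply: smallest_sub => // _ [a ->] /=.
rewrite (_ : _ @^-1` _ = [set x : T | tnth x i < a]); first exact: multiplier_set_lt.
by apply/seteqP; split => x /=; rewrite in_itv.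
Qed.

Theorem null_coeffs_ae0 h : null_coeffs h -> {ae mu, forall x, h x = 0}.
Proof.
move=> [ih h0].
have : {ae mu, forall x, setT x -> (h x)%:E = 0%E}.
  apply: (@integral_ae_eq _ T R mu setT measurableT (cst 0%E) (EFin \o h) ih) => //.
  move=> E _ mE; rewrite integral_cst// mul0e.
  have [_ _ /(_ h (conj ih h0)) [ihE hE]] := measurable_multiplier mE.
  rewrite integral_mkcond.
  transitivity (\int[mu]_x (h x * \1_E x)%:E)%E.
    apply: eq_integral => x _; rewrite patchE indicE.
    by case: (x \in E); rewrite ?mulr1 ?mulr0.
  rewrite -[LHS]fineK; last exact: integrable_fin_num.
  (* At frequency 0 and phase 0 the cosine is 1, so the vanishing coefficient of [h * \1_E] is the
     integral of [h] over [E]. *)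
  congr EFin; rewrite -(hE [tuple 0 | _ < d] 0); apply: eq_Rintegral => x _.
  rewrite add0r /dotkx big1 ?cos0 ?mulr1// => j _.
  by rewrite tnth_mktuple mul0r.
by apply: filterS => x /(_ I) [].
Qed.

End uniqueness.

(** * Complex integrals and Fourier coefficients *)

Section complex_facts.
Variable R : realType.
Implicit Types z w : R[i].

Lemma complexP z w : complex.Re z = complex.Re w -> complex.Im z = complex.Im w -> z = w.
Proof. by case: z w => [a b] [c e] /= -> ->. Qed.

Lemma ReD z w : complex.Re (z + w) = complex.Re z + complex.Re w.
Proof. by case: z w => [a b] [c e]. Qed.
Lemma ImD z w : complex.Im (z + w) = complex.Im z + complex.Im w.
Proof. by case: z w => [a b] [c e]. Qed.
Lemma ReN z : complex.Re (- z) = - complex.Re z.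
Proof. by case: z. Qed.
Lemma ImN z : complex.Im (- z) = - complex.Im z.
Proof. by case: z. Qed.
Lemma ReM z w : complex.Re (z * w) =
  complex.Re z * complex.Re w - complex.Im z * complex.Im w.
Proof. by case: z w => [a b] [c e]. Qed.
Lemma ImM z w : complex.Im (z * w) =
  complex.Re z * complex.Im w + complex.Im z * complex.Re w.
Proof. by case: z w => [a b] [c e] /=; rewrite addrC. Qed.
Lemma Re_sum I (r : seq I) P (F : I -> R[i]) :
  complex.Re (\sum_(i <- r | P i) F i) = \sum_(i <- r | P i) complex.Re (F i).
Proof. exact: (big_morph (@complex.Re R) ReD). Qed.
Lemma Im_sum I (r : seq I) P (F : I -> R[i]) :
  complex.Im (\sum_(i <- r | P i) F i) = \sum_(i <- r | P i) complex.Im (F i).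
Proof. exact: (big_morph (@complex.Im R) ImD). Qed.

Lemma cabsE z : cabs z = normc z.
Proof. by case: z. Qed.

Lemma cabs_ge0 z : 0 <= cabs z.
Proof. exact: sqrtr_ge0. Qed.

Lemma cabs0 : cabs (0 : R[i]) = 0.
Proof. by rewrite cabsE normc0. Qed.

Lemma cabsM z w : cabs (z * w) = cabs z * cabs w.
Proof. by rewrite !cabsE normcM. Qed.

Lemma cabsN z : cabs (- z) = cabs z.
Proof. by rewrite !cabsE normcN. Qed.

Lemma ler_cabsD z w : cabs (z + w) <= cabs z + cabs w.
Proof. by rewrite !cabsE le_normcD. Qed.

Lemma ler_cabs_sum I (r : seq I) P (F : I -> R[i]) :
  cabs (\sum_(i <- r | P i) F i) <= \sum_(i <- r | P i) cabs (F i).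
Proof.
elim/big_ind2 : _ => // [|z1 a z2 b h1 h2]; first by rewrite cabs0.
exact: le_trans (ler_cabsD _ _) (lerD h1 h2).
Qed.

Lemma cabs_sqr z : cabs z ^+ 2 = complex.Re z ^+ 2 + complex.Im z ^+ 2.
Proof. by rewrite /cabs sqr_sqrtr// addr_ge0// sqr_ge0. Qed.

Lemma ler_Re_cabs z : `|complex.Re z| <= cabs z.
Proof.
by rewrite -ler_sqr ?nnegrE ?cabs_ge0// cabs_sqr -normrX ger0_norm ?sqr_ge0// lerDl sqr_ge0.
Qed.

Lemma ler_Im_cabs z : `|complex.Im z| <= cabs z.
Proof.
by rewrite -ler_sqr ?nnegrE ?cabs_ge0// cabs_sqr -normrX ger0_norm ?sqr_ge0// lerDr sqr_ge0.
Qed.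

Lemma ler_cabs_ReIm z : cabs z <= `|complex.Re z| + `|complex.Im z|.
Proof.
rewrite -ler_sqr ?nnegrE ?cabs_ge0 ?addr_ge0// cabs_sqr.
rewrite sqrrD !real_normK ?num_real// lerD2r lerDl.
by rewrite mulrn_wge0// mulr_ge0.
Qed.

End complex_facts.

(** * Integrable complex functions and their Fourier coefficients *)

Section L1_theory.
Variables (R : realType) (d : nat).
Local Notation T := (pt R d).
Local Notation mu := (@tmeas R d).
Implicit Types f g : T -> R[i].

Definition cmeasurable f := measurable_fun setT (fun x => complex.Re (f x)) /\
  measurable_fun setT (fun x => complex.Im (f x)).

Definition cintegrable f :=
  mu.-integrable setT (EFin \o (fun x => complex.Re (f x))) /\
  mu.-integrable setT (EFin \o (fun x => complex.Im (f x))).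

Lemma cmeasurable_cabs f : cmeasurable f -> measurable_fun setT (fun x => cabs (f x)).
Proof.
move=> [mr mi].
apply: (measurableT_comp (f := @Num.sqrt R)).
  by apply: continuous_measurable_fun; exact: sqrt_continuous.
by apply: measurable_funD; exact: measurable_funX.
Qed.

Lemma cmeasurableM f g : cmeasurable f -> cmeasurable g ->
  cmeasurable (fun x => f x * g x).
Proof.
move=> [mf mf'] [mg mg']; split.
- under eq_fun do rewrite ReM; apply: measurable_funB; exact: measurable_funM.
- under eq_fun do rewrite ImM; apply: measurable_funD; exact: measurable_funM.
Qed.

Lemma L1P f : L1 f <-> cintegrable f.
Proof.
split=> [[mr [mi fi]]|[ir ii]].
  have ic : mu.-integrable setT (fun x => (cabs (f x))%:E).
    apply/integrableP; split; first by apply/measurable_EFinP; exact: (cmeasurable_cabs (conj mr mi)).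
    under eq_integral do rewrite /= ger0_norm ?cabs_ge0//.
    exact: fi.
  split; apply: (le_integrable measurableT _ _ ic).
  - exact/measurable_EFinP.
  - by move=> x _ /=; rewrite lee_fin [leRHS]ger0_norm ?cabs_ge0// ler_Re_cabs.
  - exact/measurable_EFinP.
  - by move=> x _ /=; rewrite lee_fin [leRHS]ger0_norm ?cabs_ge0// ler_Im_cabs.
have mr : measurable_fun setT (fun x => complex.Re (f x)).
  by apply/measurable_EFinP; exact: (measurable_int mu).
have mi : measurable_fun setT (fun x => complex.Im (f x)).
  by apply/measurable_EFinP; exact: (measurable_int mu).
split => //; split => //.
have is_ := integrableD measurableT (integrable_abse ir) (integrable_abse ii).
have ic : mu.-integrable setT (fun x => (cabs (f x))%:E).
  apply: (le_integrable measurableT _ _ is_).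
    by apply/measurable_EFinP; exact: (cmeasurable_cabs (conj mr mi)).
  move=> x _ /=; rewrite lee_fin ger0_norm ?cabs_ge0// [leRHS]ger0_norm ?addr_ge0//.
  exact: ler_cabs_ReIm.
have /integrableP[_] := ic.
by under eq_integral do rewrite /= ger0_norm ?cabs_ge0//.
Qed.

Lemma L1_cmeasurable f : L1 f -> cmeasurable f.
Proof. by move=> [mr [mi _]]; split. Qed.

Lemma L1_bounded f (M : R) : cmeasurable f -> (forall x, cabs (f x) <= M) -> L1 f.
Proof.
move=> [mr mi] fM; apply/L1P; split.
- apply: (bounded_integrable mu mr (M := M)) => x.
  exact: le_trans (ler_Re_cabs _) (fM x).
- apply: (bounded_integrable mu mi (M := M)) => x.
  exact: le_trans (ler_Im_cabs _) (fM x).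
Qed.

Lemma L1D f g : L1 f -> L1 g -> L1 (fun x => f x + g x).
Proof.
move=> /L1P[fr fi] /L1P[gr gi]; apply/L1P; split.
- rewrite (_ : _ \o _ = ((EFin \o (fun x => complex.Re (f x))) \+
    (EFin \o (fun x => complex.Re (g x))))%E); first exact: integrableD.
  by apply/funext => x /=; rewrite ReD.
- rewrite (_ : _ \o _ = ((EFin \o (fun x => complex.Im (f x))) \+
    (EFin \o (fun x => complex.Im (g x))))%E); first exact: integrableD.
  by apply/funext => x /=; rewrite ImD.
Qed.

Lemma L1M_bounded f g (M : R) : L1 f -> cmeasurable g ->
  (forall x, cabs (g x) <= M) -> L1 (fun x => f x * g x).
Proof.
move=> /L1P[fr fi] [mr mi] gM; apply/L1P.
have gMr x : `|complex.Re (g x)| <= M by rewrite (le_trans (ler_Re_cabs _)).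
have gMi x : `|complex.Im (g x)| <= M by rewrite (le_trans (ler_Im_cabs _)).
split.
- rewrite (_ : _ \o _ = ((EFin \o (fun x => complex.Re (f x) * complex.Re (g x))%R) \-
    (EFin \o (fun x => complex.Im (f x) * complex.Im (g x))%R))%E).
    by apply: integrableB => //; [exact: integrable_mul_bounded fr mr gMr|
      exact: integrable_mul_bounded fi mi gMi].
  by apply/funext => x /=; rewrite ReM.
- rewrite (_ : _ \o _ = ((EFin \o (fun x => complex.Re (f x) * complex.Im (g x))%R) \+
    (EFin \o (fun x => complex.Im (f x) * complex.Re (g x))%R))%E).
    by apply: integrableD => //; [exact: integrable_mul_bounded fr mi gMi|
      exact: integrable_mul_bounded fi mr gMr].
  by apply/funext => x /=; rewrite ImM.
Qed.

Lemma L1Z (c : R[i]) f : L1 f -> L1 (fun x => c * f x).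
Proof.
move=> f1; under eq_fun do rewrite mulrC.
apply: (L1M_bounded (M := cabs c) f1) => //.
Qed.

Lemma L1B f g : L1 f -> L1 g -> L1 (fun x => f x - g x).
Proof.
move=> f1 g1; rewrite (_ : (fun x => _) = (fun x => f x + (-1) * g x)).
  by apply: L1D => //; exact: L1Z.
by apply/funext => x; rewrite mulN1r.
Qed.

Lemma L1_cst (c : R[i]) : L1 ((fun=> c) : T -> R[i]).
Proof. by apply: (@L1_bounded _ (cabs c)) => //; split; exact: measurable_cst. Qed.

Lemma L1_sum I (r : seq I) P (F : I -> T -> R[i]) : (forall i, L1 (F i)) ->
  L1 (fun x => \sum_(i <- r | P i) F i x).
Proof.
move=> LF; elim: r => [|i r IH].
  by under eq_fun do rewrite big_nil; exact: L1_cst.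
under eq_fun do rewrite big_cons.
by case: (P i) => //; exact: L1D.
Qed.

Lemma cintD f g : L1 f -> L1 g -> cint (fun x => f x + g x) = cint f + cint g.
Proof.
move=> /L1P[fr fi] /L1P[gr gi].
apply: complexP; rewrite /cint ?ReD ?ImD/=.
- rewrite -[RHS](RintegralD measurableT fr gr).
  by apply: eq_Rintegral => x _; rewrite ReD.
- rewrite -[RHS](RintegralD measurableT fi gi).
  by apply: eq_Rintegral => x _; rewrite ImD.
Qed.

Lemma cintZ (c : R[i]) f : L1 f -> cint (fun x => c * f x) = c * cint f.
Proof.
move=> /L1P[fr fi].
have iZ (a : R) h : mu.-integrable setT (EFin \o h) -> mu.-integrable setT (EFin \o (fun x => a * h x)).
  exact: (@integrableZl _ _ _ mu setT measurableT a).
apply: complexP; rewrite ?ReM ?ImM /cint/=.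
- rewrite -[X in X - _](RintegralZl _ measurableT fr) -[X in _ - X](RintegralZl _ measurableT fi).
  rewrite -RintegralB//; [|exact: iZ|exact: iZ].
  by apply: eq_Rintegral => x _; rewrite ReM.
- rewrite -[X in X + _](RintegralZl _ measurableT fi) -[X in _ + X](RintegralZl _ measurableT fr).
  rewrite -RintegralD//; [|exact: iZ|exact: iZ].
  by apply: eq_Rintegral => x _; rewrite ImM.
Qed.

Lemma eq_cint f g : f =1 g -> cint f = cint g.
Proof. by move=> /funext ->. Qed.

Lemma cint_cst (c : R[i]) : cint ((fun=> c) : T -> R[i]) = c.
Proof. by apply: complexP; exact: Rintegral_prob_cst. Qed.

Lemma cint_sum I (r : seq I) P (F : I -> T -> R[i]) : (forall i, L1 (F i)) ->
  cint (fun x => \sum_(i <- r | P i) F i x) = \sum_(i <- r | P i) cint (F i).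
Proof.
move=> LF; elim: r => [|i r IH].
  by under eq_cint do rewrite big_nil; rewrite big_nil cint_cst.
rewrite big_cons -IH; under eq_cint do rewrite big_cons.
by case: (P i) => //; rewrite cintD//; exact: L1_sum.
Qed.

Lemma cint_ae f g : L1 f -> L1 g -> Defs.ae_eq f g -> cint f = cint g.
Proof.
move=> /L1P[fr fi] /L1P[gr gi] fg; rewrite /cint; congr (Complex (fine _) (fine _)).
- apply: ae_eq_integral => //.
  + exact: (measurable_int mu).
  + exact: (measurable_int mu).
  + by apply: filterS fg => x /= ->.
- apply: ae_eq_integral => //.
  + exact: (measurable_int mu).
  + exact: (measurable_int mu).
  + by apply: filterS fg => x /= ->.
Qed.

(* The character $x \mapsto e^{ik\cdot x}$; [cexpm k] is its conjugate. *)
Definition cexpp (k : freq d) (x : T) : R[i] :=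
  Complex (cos (dotkx k x)) (sin (dotkx k x)).

Lemma cabs_cexpp k x : cabs (cexpp k x) = 1.
Proof. by rewrite /cabs /= cos2Dsin2 sqrtr1. Qed.

Lemma cabs_cexpm k (x : T) : cabs (cexpm k x) = 1.
Proof. by rewrite /cabs /= sqrrN cos2Dsin2 sqrtr1. Qed.

Let measurable_cos_k k : measurable_fun setT (fun x : T => cos (dotkx k x)).
Proof. by have := @measurable_cos_dotkx R d k 0; under eq_fun do rewrite add0r. Qed.

Let measurable_sin_k k : measurable_fun setT (fun x : T => sin (dotkx k x)).
Proof.
have := @measurable_cos_dotkx R d k (- (pi / 2)).
by under eq_fun do rewrite addrC cosBpihalf.
Qed.

Lemma cmeasurable_cexpp k : cmeasurable (cexpp k).
Proof. by split; [exact: measurable_cos_k|exact: measurable_sin_k]. Qed.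

Lemma cmeasurable_cexpm k : cmeasurable (@cexpm R d k).
Proof.
split; [exact: measurable_cos_k|].
exact: measurable_funN (measurable_sin_k k).
Qed.

Lemma L1_cexpp k : L1 (cexpp k).
Proof.
by apply: (@L1_bounded _ 1 (cmeasurable_cexpp k)) => x; rewrite cabs_cexpp.
Qed.

Lemma L1M_cexpm f k : L1 f -> L1 (fun x => f x * cexpm k x).
Proof.
move=> f1; apply: (L1M_bounded (M := 1) f1 (cmeasurable_cexpm k)) => x.
by rewrite cabs_cexpm.
Qed.

Lemma fhatD f g k : L1 f -> L1 g ->
  fhat (fun x => f x + g x) k = fhat f k + fhat g k.
Proof.
move=> f1 g1; rewrite /fhat -cintD; [|exact: L1M_cexpm|exact: L1M_cexpm].
by apply: eq_cint => x; rewrite mulrDl.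
Qed.

Lemma fhatZ (c : R[i]) f k : L1 f -> fhat (fun x => c * f x) k = c * fhat f k.
Proof.
move=> f1; rewrite /fhat -cintZ; last exact: L1M_cexpm.
by apply: eq_cint => x; rewrite mulrA.
Qed.

Lemma fhatB f g k : L1 f -> L1 g ->
  fhat (fun x => f x - g x) k = fhat f k - fhat g k.
Proof.
move=> f1 g1; rewrite (_ : (fun x => _) = (fun x => f x + (-1) * g x)).
  by rewrite fhatD ?fhatZ ?mulN1r//; exact: L1Z.
by apply/funext => x; rewrite mulN1r.
Qed.

Lemma fhat_sum I (r : seq I) P (F : I -> T -> R[i]) k : (forall i, L1 (F i)) ->
  fhat (fun x => \sum_(i <- r | P i) F i x) k = \sum_(i <- r | P i) fhat (F i) k.
Proof.
move=> LF; rewrite /fhat -cint_sum; last by move=> i; exact: L1M_cexpm.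
by apply: eq_cint => x; rewrite mulr_suml.
Qed.

Lemma fhat_ae f g k : L1 f -> L1 g -> Defs.ae_eq f g -> fhat f k = fhat g k.
Proof.
move=> f1 g1 fg; apply: cint_ae; [exact: L1M_cexpm|exact: L1M_cexpm|].
by apply: filterS fg => x ->.
Qed.

Lemma fhat_cexpp j k : fhat (cexpp j) k = (j == k)%:R.
Proof.
pose l : freq d := [tuple tnth j i - tnth k i | i < d].
have lE (x : T) : dotkx l x = dotkx j x - dotkx k x.
  rewrite /dotkx -sumrB; apply: eq_bigr => i _.
  by rewrite tnth_mktuple rmorphB/= mulrBl.
(* The sine is written as a cosine with phase [- (pi / 2)], so that [Rintegral_cos_dotkx] treats the
   real and the imaginary part alike. *)
have E x : cexpp j x * cexpm k x =
    Complex (cos (0 + dotkx l x)) (cos (- (pi / 2) + dotkx l x)).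
  rewrite add0r addrC cosBpihalf lE.
  by apply: complexP; rewrite ?ReM ?ImM/= ?cosB ?sinB; ring.
rewrite /fhat (eq_cint E) /cint/=.
have [jk|jk] := eqVneq j k.
  apply: complexP; rewrite /= -[RHS](Rintegral_prob_cst mu).
    by apply: eq_Rintegral => x _; rewrite lE jk subrr addr0 cos0.
  apply: eq_Rintegral => x _.
  by rewrite lE jk subrr addr0 cosN cos_pihalf.
have l0 : l != [tuple 0 | _ < d].
  apply: contra jk => /eqP lE0; apply/eqP/eq_from_tnth => i.
  have := congr1 (fun u => tnth u i) lE0.
  by rewrite !tnth_mktuple => /eqP; rewrite subr_eq0 => /eqP.
by apply: complexP => /=; exact: Rintegral_cos_dotkx.
Qed.

(** The coefficient at [k] mixes the cosine and sine integrals of the real and imaginary parts of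
    [f]. The equations at [k] and [- k] together separate the four integrals, so both parts are real
    functions with vanishing coefficients. *)
Lemma fhat_eq0_ae f : L1 f -> (forall k, fhat f k = 0) ->
  Defs.ae_eq f (fun=> 0).
Proof.
move=> f1 f0; have /L1P[fr fi] := f1.
pose nk (k : freq d) : freq d := [tuple - tnth k i | i < d].
have nkE k (x : T) : dotkx (nk k) x = - dotkx k x.
  rewrite /dotkx -sumrN; apply: eq_bigr => i _.
  by rewrite tnth_mktuple rmorphN/= mulNr.
pose a x := complex.Re (f x); pose b x := complex.Im (f x).
have icos h k : mu.-integrable setT (EFin \o h) ->
    mu.-integrable setT (EFin \o (fun x => h x * cos (dotkx k x))).
  move=> ih; apply: (integrable_mul_bounded ih (measurable_cos_k k)) => x.
  exact: cos_max.
have isin h k : mu.-integrable setT (EFin \o h) ->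
    mu.-integrable setT (EFin \o (fun x => h x * sin (dotkx k x))).
  move=> ih; apply: (integrable_mul_bounded ih (measurable_sin_k k)) => x.
  exact: sin_max.
have Hr k : \int[mu]_x (a x * cos (dotkx k x)) + \int[mu]_x (b x * sin (dotkx k x)) = 0.
  have := congr1 (@complex.Re R) (f0 k); rewrite /fhat /cint /= => <-.
  rewrite -RintegralD//; [|exact: icos|exact: isin].
  by apply: eq_Rintegral => x _; rewrite ReM /= mulrN opprK.
have Hi k : \int[mu]_x (b x * cos (dotkx k x)) - \int[mu]_x (a x * sin (dotkx k x)) = 0.
  have := congr1 (@complex.Im R) (f0 k); rewrite /fhat /cint /= => <-.
  rewrite -RintegralB//; [|exact: icos|exact: isin].
  by apply: eq_Rintegral => x _; rewrite ImM /= mulrN addrC.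
have nc h k : \int[mu]_x (h x * cos (dotkx (nk k) x)) = \int[mu]_x (h x * cos (dotkx k x)).
  by apply: eq_Rintegral => x _; rewrite nkE cosN.
have ns h k : mu.-integrable setT (EFin \o h) ->
  \int[mu]_x (h x * sin (dotkx (nk k) x)) = - \int[mu]_x (h x * sin (dotkx k x)).
  move=> ih; rewrite -mulN1r -RintegralZl//; last exact: isin.
  by apply: eq_Rintegral => x _; rewrite nkE sinN; ring.
have nullP h : mu.-integrable setT (EFin \o h) ->
    (forall k, \int[mu]_x (h x * cos (dotkx k x)) = 0) ->
    (forall k, \int[mu]_x (h x * sin (dotkx k x)) = 0) -> null_coeffs h.
  move=> ih hc hs; split => // k th.
  transitivity (cos th * \int[mu]_x (h x * cos (dotkx k x)) -
      sin th * \int[mu]_x (h x * sin (dotkx k x))); last by rewrite hc hs !mulr0 subr0.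
  rewrite -(RintegralZl _ measurableT (icos _ k ih)) -(RintegralZl _ measurableT (isin _ k ih)).
  rewrite -RintegralB//.
  - by apply: eq_Rintegral => x _; rewrite cosD; ring.
  - exact: (@integrableZl _ _ _ mu setT measurableT (cos th) _ (icos _ _ ih)).
  - exact: (@integrableZl _ _ _ mu setT measurableT (sin th) _ (isin _ _ ih)).
have Na : null_coeffs a.
  apply: nullP => // k.
    by have := Hr k; have := Hr (nk k); rewrite nc ns//; lra.
  by have := Hi k; have := Hi (nk k); rewrite nc ns//; lra.
have Nb : null_coeffs b.
  apply: nullP => // k.
    by have := Hi k; have := Hi (nk k); rewrite nc ns//; lra.
  by have := Hr k; have := Hr (nk k); rewrite nc ns//; lra.
apply: filterS2 (null_coeffs_ae0 Na) (null_coeffs_ae0 Nb) => x ax bx.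
exact: complexP.
Qed.

Lemma fhat_inj_ae f g : L1 f -> L1 g -> (forall k, fhat f k = fhat g k) ->
  Defs.ae_eq f g.
Proof.
move=> f1 g1 fg.
have : Defs.ae_eq (fun x => f x - g x) (fun=> 0).
  apply: fhat_eq0_ae => [|k]; first exact: L1B.
  by rewrite fhatB// fg subrr.
by apply: filterS => x /eqP; rewrite subr_eq0 => /eqP.
Qed.

End L1_theory.

(** * Fourier inversion in the Wiener algebra *)

Section csum.
Variable R : realType.
Implicit Types (z : nat -> R[i]) (m : nat -> R).

(** Summed by components, so that only limits of real sequences occur; the lemmas about it assume a
    summable majorant. *)
Definition csum z : R[i] :=
  Complex (limn (series (fun j => complex.Re (z j))))
          (limn (series (fun j => complex.Im (z j)))).

Lemma cvg_Re_csum z m : (forall j, cabs (z j) <= m j) -> cvgn (series m) ->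
  series (fun j => complex.Re (z j)) @ \oo --> complex.Re (csum z).
Proof.
move=> zm cm; apply: normed_cvg; apply: (series_le_cvg _ _ _ cm) => j /=.
- exact: normr_ge0.
- exact: le_trans (cabs_ge0 _) (zm j).
- exact: le_trans (ler_Re_cabs _) (zm j).
Qed.

Lemma cvg_Im_csum z m : (forall j, cabs (z j) <= m j) -> cvgn (series m) ->
  series (fun j => complex.Im (z j)) @ \oo --> complex.Im (csum z).
Proof.
move=> zm cm; apply: normed_cvg; apply: (series_le_cvg _ _ _ cm) => j /=.
- exact: normr_ge0.
- exact: le_trans (cabs_ge0 _) (zm j).
- exact: le_trans (ler_Im_cabs _) (zm j).
Qed.

(** The finite sums over [[N, M)] obey the bound and [M] tends to infinity; squaring lets the limit
    pass through real and imaginary parts. The bound depends on the majorant only, so it gives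
    uniform convergence when [z] varies with a point. *)
Lemma csum_tail z m : (forall j, cabs (z j) <= m j) -> cvgn (series m) ->
  forall N, cabs (csum z - \sum_(0 <= j < N) z j) <= limn (series m) - series m N.
Proof.
move=> zm cm N; set t := _ - series m N.
have m0 j : 0 <= m j by rewrite (le_trans (cabs_ge0 _) (zm j)).
have ms n : series m n <= limn (series m).
  apply: nondecreasing_cvgn_le => //; apply: nondecreasing_series => j _ _.
  exact: m0.
have t0 : 0 <= t by rewrite subr_ge0.
rewrite -ler_sqr ?nnegrE ?cabs_ge0// cabs_sqr.
set a := complex.Re _; set b := complex.Im _.
pose u M := series (fun j => complex.Re (z j)) M - complex.Re (\sum_(0 <= j < N) z j).
pose v M := series (fun j => complex.Im (z j)) M - complex.Im (\sum_(0 <= j < N) z j).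
have ua : u @ \oo --> a.
  rewrite /a ReD ReN; apply: cvgB; last exact: cvg_cst.
  exact: cvg_Re_csum zm cm.
have vb : v @ \oo --> b.
  rewrite /b ImD ImN; apply: cvgB; last exact: cvg_cst.
  exact: cvg_Im_csum zm cm.
have h : (fun M => u M ^+ 2 + v M ^+ 2) @ \oo --> a ^+ 2 + b ^+ 2.
  by apply: cvgD; rewrite !expr2; exact: cvgM.
apply: (ler_cvg_to h (cvg_cst (t ^+ 2))).
exists N => // M /= NM.
have E : \sum_(0 <= j < M) z j - \sum_(0 <= j < N) z j = \sum_(N <= j < M) z j.
  by rewrite [X in X - _](big_cat_nat (leq0n N) NM)/=; ring.
have -> : u M ^+ 2 + v M ^+ 2 = cabs (\sum_(N <= j < M) z j) ^+ 2.
  by rewrite cabs_sqr -E ReD ImD ReN ImN [in RHS]Re_sum [in RHS]Im_sum.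
rewrite ler_sqr ?nnegrE ?cabs_ge0//.
apply: (le_trans (ler_cabs_sum _ _ _)).
apply: (@le_trans _ _ (\sum_(N <= j < M) m j)); first by apply: ler_sum.
rewrite /t -(sub_series_geq _ NM) lerD2r; exact: ms.
Qed.

End csum.

(** * Continuous periodic functions *)

Section cont_per.
Variables (R : realType) (d : nat).
Local Notation T := (pt R d).

Lemma cont_per_cst (c : R[i]) : cont_per ((fun=> c) : T -> R[i]).
Proof.
by split => // x e e0; exists 1 => // y _; rewrite subrr cabs0.
Qed.

Lemma cont_perD (f g : T -> R[i]) : cont_per f -> cont_per g ->
  cont_per (fun x => f x + g x).
Proof.
move=> [cf pf] [cg pg]; split=> [x e e0|x y xy]; last by rewrite (pf _ _ xy) (pg _ _ xy).
have [a a0 ha] := cf x _ (divr_gt0 e0 (ltr0n _ 2)).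
have [b b0 hb] := cg x _ (divr_gt0 e0 (ltr0n _ 2)).
exists (Num.min a b); first by rewrite lt_min a0.
move=> y xy; rewrite opprD addrACA (le_lt_trans (ler_cabsD _ _))// [ltRHS]splitr.
by rewrite ltrD// ?ha ?hb// => i; have := xy i; rewrite lt_min => /andP[].
Qed.

Lemma cont_perZ (c : R[i]) (f : T -> R[i]) : cont_per f ->
  cont_per (fun x => c * f x).
Proof.
move=> [cf pf]; split=> [x e e0|x y xy]; last by rewrite (pf _ _ xy).
have c0 : 0 < cabs c + 1 by rewrite ltr_wpDl// cabs_ge0.
have [a a0 ha] := cf x _ (divr_gt0 e0 c0).
exists a => // y /ha h; rewrite -mulrBr cabsM.
rewrite (@le_lt_trans _ _ ((cabs c + 1) * cabs (f x - f y)))//.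
  by rewrite ler_wpM2r ?cabs_ge0// lerDl.
by rewrite mulrC -ltr_pdivlMr.
Qed.

Lemma cont_per_cexpp (k : freq d) : cont_per (@cexpp R d k).
Proof.
split=> [x e e0|x y xy]; last first.
  have [m mE] : exists m : int, dotkx k y = dotkx k x + m%:~R * (2 * pi).
    have /choice[ms msE] := xy.
    exists (\sum_(i < d) tnth k i * ms i).
    rewrite /dotkx rmorph_sum/= mulr_suml -big_split/=.
    by apply: eq_bigr => i _; rewrite msE mulrDr rmorphM/= mulrA.
  by rewrite /cexpp mE cos_intD2pi sin_intD2pi.
(* A Lipschitz constant of [dotkx k] for the maximum distance. The radius below divides by [A + 1]
   because [A] is 0 when [k] is. *)
pose A : R := \sum_(i < d) `|(tnth k i)%:~R|.
have A0 : 0 <= A by apply: sumr_ge0.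
have dot (y : T) del : (forall i, `|tnth x i - tnth y i| < del) ->
    `|dotkx k x - dotkx k y| <= A * del.
  move=> xy; rewrite /dotkx -sumrB mulr_suml.
  apply: (le_trans (ler_norm_sum _ _ _)); apply: ler_sum => i _.
  by rewrite -mulrBr normrM ler_wpM2l// ltW.
have e2 : 0 < e / 2 by rewrite divr_gt0.
have /cvgrPdist_lt/(_ _ e2)/nbhs_ballP[r1 /= r10 h1] := @continuous_cos R (dotkx k x).
have /cvgrPdist_lt/(_ _ e2)/nbhs_ballP[r2 /= r20 h2] := @continuous_sin R (dotkx k x).
have A1 : 0 < A + 1 by rewrite ltr_wpDl.
exists (Num.min r1 r2 / (A + 1)); first by rewrite divr_gt0// lt_min r10.
move=> y /dot xy.
have {}xy : `|dotkx k x - dotkx k y| < Num.min r1 r2.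
  apply: (le_lt_trans xy); rewrite mulrCA gtr_pMr ?lt_min ?r10//.
  by rewrite ltr_pdivrMr// mul1r ltrDl.
move: xy; rewrite lt_min => /andP[/h1 xy1 /h2 xy2].
rewrite (le_lt_trans (ler_cabs_ReIm _))// ReD ImD ReN ImN [ltRHS]splitr.
exact: ltrD.
Qed.

Lemma cont_per_sum I (r : seq I) P (F : I -> T -> R[i]) :
  (forall i, cont_per (F i)) -> cont_per (fun x => \sum_(i <- r | P i) F i x).
Proof.
move=> cF; elim: r => [|i r IH].
  by under eq_fun do rewrite big_nil; exact: cont_per_cst.
under eq_fun do rewrite big_cons.
by case: (P i) => //; exact: cont_perD.
Qed.

End cont_per.

Section inversion.
Variables (R : realType) (d : nat) (e : nat -> freq d) (e_bij : bijective e).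
Local Notation T := (pt R d).
Local Notation mu := (@tmeas R d).
Implicit Types f g : T -> R[i].

Lemma esum_enum (a : freq d -> \bar R) (D : set nat) :
  (\esum_(k in e @` D) a k = \esum_(j in D) a (e j))%E.
Proof.
apply: reindex_esum; split=> [j Dj|j j' _ _|k [j Dj <-]]; [by exists j| |by exists j].
exact: (bij_inj e_bij).
Qed.

Lemma image_enum_setT : e @` setT = setT.
Proof.
by apply/seteqP; split => // k _; case: e_bij => e' _ e'K; exists (e' k).
Qed.

Lemma esum_enumT (a : freq d -> \bar R) :
  (\esum_(k in [set: freq d]) a k = \esum_(j in [set: nat]) a (e j))%E.
Proof. by rewrite -image_enum_setT esum_enum. Qed.

Lemma Anorm_partial f N :
  ((\sum_(0 <= j < N) cabs (fhat f (e j)))%:E <= Anorm f)%E.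
Proof.
rewrite /Anorm esum_enumT -nneseries_esumT; last by move=> j; rewrite lee_fin cabs_ge0.
rewrite -sumEFin; apply: nneseries_lim_ge => j _ _.
by rewrite lee_fin cabs_ge0.
Qed.

(** The factor 2 comes from bounding real and imaginary part separately; it is harmless, as the
    bound is applied with [M] tending to 0. *)
Lemma cabs_cint_le g (M : R) : L1 g -> (forall x, cabs (g x) <= M) ->
  cabs (cint g) <= M + M.
Proof.
move=> /L1P[gr gi] gM; apply: (le_trans (ler_cabs_ReIm _)).
have H h : mu.-integrable setT (EFin \o h) -> (forall x, `|h x| <= M) ->
    `|\int[mu]_x h x| <= M.
  move=> ih hM; apply: (le_trans (le_normr_Rintegral measurableT ih)).
  rewrite -[leRHS](Rintegral_prob_cst mu); apply: le_Rintegral => //.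
  - exact: (integrable_abse ih).
  - exact: finite_measure_integrable_cst.
by apply: lerD; apply: H => // x; apply: (le_trans _ (gM x));
  [exact: ler_Re_cabs|exact: ler_Im_cabs].
Qed.

(** Weierstrass test: the Fourier series converges uniformly to a continuous periodic [h]. A partial
    sum that includes the index of [k] has the same [k]-th coefficient as [f], so by uniform
    convergence [h] has the coefficients of [f], and uniqueness gives [f = h] almost everywhere. *)
Lemma Anorm_cont_rep f : L1 f -> (Anorm f < +oo)%E ->
  exists h, [/\ cont_per h, Defs.ae_eq f h &
    forall x, ((cabs (h x))%:E <= Anorm f)%E].
Proof.
move=> f1 fA.
have A0 : (0 <= Anorm f)%E by apply: esum_ge0 => k _; rewrite lee_fin cabs_ge0.
have fin : Anorm f \is a fin_num by rewrite ge0_fin_numE.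
pose m j := cabs (fhat f (e j)).
have m0 j : 0 <= m j by exact: cabs_ge0.
have mB N : series m N <= fine (Anorm f).
  by rewrite -lee_fin fineK//; exact: Anorm_partial.
have cm : cvgn (series m).
  apply: nondecreasing_is_cvgn.
    by apply: nondecreasing_series => j _ _; exact: m0.
  by exists (fine (Anorm f)) => _ [N _ <-].
have limB : limn (series m) <= fine (Anorm f) by apply: limr_le => //; exact: nearW.
pose z x j := fhat f (e j) * cexpp (e j) x.
have zm x j : cabs (z x j) <= m j by rewrite cabsM cabs_cexpp mulr1.
pose h x := csum (z x).
pose S N x := \sum_(0 <= j < N) z x j.
pose t N := limn (series m) - series m N.
have hS N x : cabs (h x - S N x) <= t N by exact: csum_tail.
have t0 : t @ \oo --> 0.
  rewrite -(subrr (limn (series m))).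
  by apply: cvgB; [exact: cvg_cst|exact: cm].
have tsmall eps : 0 < eps -> exists N0, forall N, (N0 <= N)%N -> t N < eps.
  move=> eps0; have /cvgrPdist_lt/(_ _ eps0)[N0 _ HN] := t0.
  exists N0 => N N0N; have := HN N N0N; rewrite sub0r normrN.
  exact: le_lt_trans (ler_norm _).
have cS N : cont_per (S N).
  by apply: cont_per_sum => j; apply: cont_perZ; exact: cont_per_cexpp.
have ch : cont_per h.
  split=> [x eps eps0|x y xy].
    have e3 : 0 < eps / 3 by rewrite divr_gt0.
    have [N HN] := tsmall _ e3; have {}HN := HN N (leqnn _).
    have [cSN _] := cS N; have [del del0 hd] := cSN x _ e3.
    exists del => // y /hd xy.
    have -> : h x - h y = (h x - S N x) + (S N x - S N y) + - (h y - S N y) by ring.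
    apply: (le_lt_trans (ler_cabsD _ _)).
    have := ler_cabsD (h x - S N x) (S N x - S N y).
    have := hS N x; have := hS N y; rewrite cabsN; lra.
  rewrite /h; congr csum; apply/funext => j; rewrite /z; congr (_ * _).
  by have [_ /(_ _ _ xy) ->] := cont_per_cexpp R (e j).
have mz j : cmeasurable (fun x => z x j).
  apply: cmeasurableM; last exact: cmeasurable_cexpp.
  by split; exact: measurable_cst.
have mh : cmeasurable h.
  split.
    apply: (measurable_fun_cvg (h := fun N x => series (fun j => complex.Re (z x j)) N)).
      by move=> N; rewrite /series/=; apply: measurable_sum => j; have [] := mz j.
    by move=> x _; exact: cvg_Re_csum (zm x) cm.
  apply: (measurable_fun_cvg (h := fun N x => series (fun j => complex.Im (z x j)) N)).
    by move=> N; rewrite /series/=; apply: measurable_sum => j; have [] := mz j.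
  by move=> x _; exact: cvg_Im_csum (zm x) cm.
have hA x : cabs (h x) <= limn (series m).
  (* The tail estimate at [N = 0] is the bound of [h] by the whole sum. *)
  have := hS 0%N x; rewrite /S /t /series/= !big_geq// !subr0.
  exact.
have h1 : L1 h by exact: L1_bounded mh hA.
have S1 N : L1 (S N) by apply: L1_sum => j; apply: L1Z; exact: L1_cexpp.
exists h; split => // [|x].
  apply: fhat_inj_ae => // k; apply/esym/eqP; rewrite -subr_eq0.
  have [e' eK e'K] := e_bij.
  have kS N : (e' k < N)%N -> fhat (S N) k = fhat f k.
    move=> kN; rewrite /S fhat_sum; last by move=> j; apply: L1Z; exact: L1_cexpp.
    rewrite big_mkord (bigD1 (Ordinal kN))//= fhatZ; last exact: L1_cexpp.
    rewrite fhat_cexpp e'K eqxx mulr1 big1 ?addr0// => j jk.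
    rewrite fhatZ; last exact: L1_cexpp.
    rewrite fhat_cexpp (_ : _ == _ = false) ?mulr0//; apply/negbTE.
    by apply: contra jk => /eqP jk; apply/eqP/val_inj; rewrite /= -jk eK.
  have bound N : (e' k < N)%N -> cabs (fhat h k - fhat f k) <= t N + t N.
    move=> kN; rewrite -(kS _ kN).
    rewrite -fhatB//; apply: cabs_cint_le => [|x]; first exact/L1M_cexpm/L1B.
    by rewrite cabsM cabs_cexpm mulr1.
  suff : cabs (fhat h k - fhat f k) <= 0.
    move=> H; have /eqP := H; rewrite cabsE; move=> /eqP H'.
    apply/eqP/eq0_normc/eqP; rewrite eq_le -cabsE H; exact: cabs_ge0.
  apply/ler_addgt0Pr => eps eps0; rewrite add0r.
  have [N0 HN] := tsmall _ (divr_gt0 eps0 (ltr0n _ 2)).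
  have := bound _ (leq_maxl (e' k).+1 N0); have := HN _ (leq_maxr (e' k).+1 N0).
  lra.
by rewrite -[leRHS]fineK// lee_fin (le_trans (hA x)).
Qed.

(** * Comparison of the three target norms *)

Lemma Linfnorm_le_Cnorm f : (Linfnorm f <= Cnorm f)%E.
Proof.
apply: le_ereal_inf_tmp => _ [h [ch fh] <-]; apply: ereal_inf_lbound => /=.
apply: filterS fh => x ->; apply: ereal_sup_ubound; by exists x.
Qed.

Lemma Cnorm_le_Anorm f : L1 f -> (Cnorm f <= Anorm f)%E.
Proof.
move=> f1; have [fA|] := ltP (Anorm f) +oo%E; last by rewrite leye_eq => /eqP ->; rewrite leey.
have [h [ch fh hA]] := Anorm_cont_rep f1 fA.
apply: (@le_trans _ _ (ereal_sup (range (fun x => (cabs (h x))%:E)))).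
  by apply: ereal_inf_lbound; exists h.
by apply: ge_ereal_sup => _ [x _ <-].
Qed.

Lemma Linfnorm_le_Gnorm G f : L1 f -> (Linfnorm f <= Gnorm G f)%E.
Proof.
move=> f1; case: G => //=; last exact: Linfnorm_le_Cnorm.
exact: le_trans (Linfnorm_le_Cnorm f) (Cnorm_le_Anorm f1).
Qed.

Lemma Gnorm_le_Anorm G f : L1 f -> (Gnorm G f <= Anorm f)%E.
Proof.
move=> f1; case: G => //=; first exact: Cnorm_le_Anorm.
exact: le_trans (Linfnorm_le_Cnorm f) (Cnorm_le_Anorm f1).
Qed.

Lemma inA_inG G f : inA f -> inG G f.
Proof.
move=> [f1 fA]; case: G => //=; split => //.
  by have [h [ch fh _]] := Anorm_cont_rep f1 fA; exists h.
exact: le_lt_trans (Gnorm_le_Anorm Linfty f1) fA.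
Qed.

End inversion.

(** * Partial Fourier sums *)

Section esum_facts.
Context {R : realType} {I : choiceType}.
Implicit Types (D : set I) (a b : I -> R).

Lemma le_esumZ D (c : R) a : 0 <= c -> (forall i, 0 <= a i) ->
  (\esum_(i in D) (c * a i)%:E <= c%:E * \esum_(i in D) (a i)%:E)%E.
Proof.
move=> c0 a0; apply: ge_ereal_sup => _ [X [finX XD] <-].
under eq_fsbigr do rewrite EFinM.
rewrite -ge0_mule_fsumr; last by move=> i; rewrite lee_fin.
by apply: lee_wpmul2l; [rewrite lee_fin|apply: esum_ge; exists X].
Qed.

(** A form of Cauchy-Schwarz without square roots of extended reals: termwise, the right side minus
    the left is [t^-1 / 2 * (t * a i - b i) ^+ 2]. The sharp inequality follows by choosing [t]. *)
Lemma esum_AMGM D a b (t : R) : 0 < t -> (forall i, 0 <= a i) -> (forall i, 0 <= b i) ->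
  (\esum_(i in D) (a i * b i)%:E <=
   (t / 2)%:E * (\esum_(i in D) (a i ^+ 2)%:E) + (t^-1 / 2)%:E * \esum_(i in D) (b i ^+ 2)%:E)%E.
Proof.
move=> t0 a0 b0.
have t20 : 0 <= t / 2 by rewrite divr_ge0// ltW.
have t20' : 0 <= t^-1 / 2 by rewrite divr_ge0// invr_ge0 ltW.
apply: (@le_trans _ _ (\esum_(i in D) ((t / 2 * a i ^+ 2)%:E + (t^-1 / 2 * b i ^+ 2)%:E))%E).
  apply: le_esum => i _; rewrite -EFinD lee_fin -subr_ge0.
  have -> : t / 2 * a i ^+ 2 + t^-1 / 2 * b i ^+ 2 - a i * b i =
      t^-1 / 2 * (t * a i - b i) ^+ 2 by field; rewrite gt_eqF.
  by rewrite mulr_ge0// sqr_ge0.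
rewrite esumD; last 2 first.
- by move=> i _; rewrite lee_fin mulr_ge0// sqr_ge0.
- by move=> i _; rewrite lee_fin mulr_ge0// sqr_ge0.
by apply: leeD; apply: le_esumZ => // i; exact: sqr_ge0.
Qed.

Lemma le_esum_term D a i : D i -> ((a i)%:E <= \esum_(j in D) (a j)%:E)%E.
Proof.
move=> Di; apply: esum_ge; exists [set i]; last by rewrite fsbig_set1.
by split; [exact: finite_set1|move=> _ ->].
Qed.

End esum_facts.

Section upper_bound.
Variables (R : realType) (d : nat) (w : freq d -> R) (e : nat -> freq d).
Hypotheses (w_pos : forall k, 0 < w k) (e_bij : bijective e).
Hypothesis w_sum : (\esum_(k in [set: freq d]) ((w k) ^-2)%:E < +oo)%E.
Local Notation T := (pt R d).
Implicit Types f g : T -> R[i].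

Definition trigpoly (N : nat) (c : nat -> R[i]) (x : T) : R[i] :=
  \sum_(j < N) c j * cexpp (e j) x.

Lemma L1_trigpoly N c : L1 (trigpoly N c).
Proof. by apply: L1_sum => j; apply: L1Z; exact: L1_cexpp. Qed.

Lemma fhat_trigpoly N c j : fhat (trigpoly N c) (e j) = if (j < N)%N then c j else 0.
Proof.
rewrite fhat_sum; last by move=> i; apply: L1Z; exact: L1_cexpp.
under eq_bigr => i _ do rewrite (fhatZ _ _ (L1_cexpp R (e i))) fhat_cexpp (inj_eq (bij_inj e_bij)).
case: ifPn => jN.
  rewrite (bigD1 (Ordinal jN))//= eqxx mulr1 big1 ?addr0// => i ij.
  rewrite (_ : (_ == _) = false) ?mulr0//; apply/negbTE.
  by apply: contra ij => /eqP ij; apply/eqP/val_inj.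
rewrite big1// => i _; case: eqP => [ij|_]; last by rewrite mulr0.
by move: jN; rewrite -ij ltn_ord.
Qed.

Lemma Anorm_trigpoly N c : Anorm (trigpoly N c) = (\sum_(j < N) cabs (c j))%:E.
Proof.
rewrite /Anorm (esum_enumT e_bij).
transitivity (\esum_(j in `I_N) (cabs (c j))%:E)%E.
  rewrite [RHS]esum_mkcond; apply: eq_esum => j _; rewrite fhat_trigpoly.
  case: ifPn => jN; first by rewrite mem_set.
  by rewrite memNset ?cabs0//=; exact/negP.
rewrite esum_fset//; last by move=> j _; rewrite lee_fin cabs_ge0.
by rewrite -fsbig_ord sumEFin.
Qed.

Lemma inA_trigpoly N c : inA (trigpoly N c).
Proof. by split; [exact: L1_trigpoly|rewrite Anorm_trigpoly ltry]. Qed.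

Lemma inA_cexpp j : inA (cexpp (R := R) (e j)).
Proof.
rewrite (_ : cexpp (e j) = trigpoly j.+1 (fun i => (i == j)%:R)).
  exact: inA_trigpoly.
apply/funext => x; rewrite /trigpoly big_ord_recr/= eqxx mul1r big1 ?add0r// => i _.
by rewrite (ltn_eqF (ltn_ord i)) mul0r.
Qed.

Lemma fhat_le_Fnorm f k : inF w f -> ((cabs (fhat f k))%:E <= (w k)^-1%:E * Fnorm w f)%E.
Proof.
move=> [f1 f2]; rewrite /Fnorm f2.
have F0 : (0 <= Fnorm2 w f)%E.
  by apply: esum_ge0 => j _; rewrite lee_fin mulr_ge0// sqr_ge0.
have fin : Fnorm2 w f \is a fin_num by rewrite ge0_fin_numE.
rewrite -EFinM lee_fin mulrC ler_pdivlMr// mulrC.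
have wk : 0 <= w k * cabs (fhat f k) by rewrite mulr_ge0 ?cabs_ge0// ltW.
rewrite -[leLHS]ger0_norm// -sqrtr_sqr; apply: ler_wsqrtr.
rewrite exprMn -lee_fin fineK//.
exact: (le_esum_term (fun k => w k ^+ 2 * cabs (fhat f k) ^+ 2)).
Qed.

Definition partial_sum N f : T -> R[i] := trigpoly N (fun j => fhat f (e j)).

Lemma partial_sum_admissible G n N : (N < n)%N -> admissible G w n (partial_sum N).
Proof.
move=> Nn; split.
- by move=> f _; apply: (inA_inG e_bij); exact: inA_trigpoly.
- move=> f g [f1 _] [g1 _] fg; rewrite (_ : partial_sum N f = partial_sum N g); first exact: aeW.
  rewrite /partial_sum; congr trigpoly; apply/funext => j; exact: fhat_ae.
- move=> f g c [f1 _] [g1 _]; apply: aeW => x; rewrite /partial_sum /trigpoly mulr_sumr -big_split/=.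
  apply: eq_bigr => j _; rewrite fhatD//; last exact: L1Z.
  by rewrite fhatZ// mulrDl mulrA.
- exists (\sum_(j < N) (w (e j))^-1) => f Ff.
  apply: (le_trans (Gnorm_le_Anorm e_bij G (L1_trigpoly _ _))).
  rewrite Anorm_trigpoly -!sumEFin ge0_sume_distrl; last first.
    by move=> i _; rewrite lee_fin invr_ge0 ltW.
  by apply: lee_sum => j _; exact: fhat_le_Fnorm.
- exists N => //; exists (fun i => cexpp (e i)); split.
    by move=> i; apply: (inA_inG e_bij); exact: inA_cexpp.
  by move=> f _; exists (fun i => fhat f (e i)); exact: aeW.
Qed.

Local Notation tail N := (\esum_(j in [set j : nat | (N <= j)%N]) ((w (e j)) ^-2)%:E)%E.

Lemma tail_fin_num N : tail N \is a fin_num.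
Proof.
have wj j : (0 <= ((w (e j)) ^-2)%:E)%E by rewrite lee_fin invr_ge0 sqr_ge0.
rewrite ge0_fin_numE; last by apply: esum_ge0.
apply: le_lt_trans w_sum; rewrite (esum_enumT e_bij) [leLHS]esum_mkcond.
by apply: le_esum => j _; case: ifP.
Qed.

(** The square root of the tail will be the parameter [t] of [esum_AMGM], which has to be
    positive. *)
Lemma tail_gt0 N : 0 < fine (tail N).
Proof.
rewrite -lte_fin fineK ?tail_fin_num//.
apply: (@lt_le_trans _ _ ((w (e N)) ^-2)%:E).
  by rewrite lte_fin invr_gt0 exprn_gt0.
exact: (le_esum_term (fun j => (w (e j)) ^-2)) (leqnn N).
Qed.

Lemma opnorm_partial_sum_le G N :
  (opnorm_IminusA G w (partial_sum N) <= (Num.sqrt (fine (tail N)))%:E)%E.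
Proof.
apply: ge_ereal_sup => _ [f [[f1 fF] fn1] <-].
have L1r : L1 (fun x => f x - partial_sum N f x).
  by apply: L1B => //; exact: L1_trigpoly.
apply: (le_trans (Gnorm_le_Anorm e_bij G L1r)).
have rE j : fhat (fun x => f x - partial_sum N f x) (e j) =
    if (N <= j)%N then fhat f (e j) else 0.
  rewrite fhatB//; last exact: L1_trigpoly.
  rewrite fhat_trigpoly ltnNge.
  by case: leqP => _ /=; rewrite ?subr0 ?subrr.
set s := Num.sqrt _.
have s0 : 0 < s by rewrite sqrtr_gt0 tail_gt0.
have s2 : (tail N = (s ^+ 2)%:E)%E.
  by rewrite sqr_sqrtr ?fineK ?tail_fin_num// ltW// tail_gt0.
have F0 : (0 <= Fnorm2 w f)%E.
  by apply: esum_ge0 => j _; rewrite lee_fin mulr_ge0// sqr_ge0.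
have F1 : (Fnorm2 w f <= 1)%E.
  move: fn1; rewrite /Fnorm fF lee_fin => fn1.
  have fin : Fnorm2 w f \is a fin_num by rewrite ge0_fin_numE.
  rewrite -(fineK fin) lee_fin -(@ler_sqrt _ _ 1)// sqrtr1 //.
rewrite /Anorm (esum_enumT e_bij).
apply: (@le_trans _ _ (\esum_(j in [set j : nat | (N <= j)%N])
    ((w (e j) * cabs (fhat f (e j))) * (w (e j))^-1)%:E)%E).
  rewrite [leRHS]esum_mkcond; apply: le_esum => j _; rewrite rE.
  case: ifPn => jN; last by rewrite cabs0; case: ifPn => // _; rewrite lee_fin !mulr_ge0 ?cabs_ge0 ?invr_ge0 // ltW.
  by rewrite mem_set// lee_fin mulrC mulKf// gt_eqF.
(* With [t = s], where [s ^+ 2] is the tail and the sum of [(w * |fhat f|)^2] is at most 1, the two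
   summands are at most [s / 2] each. *)
apply: (le_trans (esum_AMGM _ s0 _ _)).
- by move=> j; rewrite mulr_ge0 ?cabs_ge0// ltW.
- by move=> j; rewrite invr_ge0 ltW.
under [X in (_ + _ * X)%E]eq_esum do rewrite exprVn.
rewrite s2.
apply: (@le_trans _ _ ((s / 2)%:E * 1 + (s^-1 / 2)%:E * (s ^+ 2)%:E)%E); last first.
  by rewrite mule1 -EFinM -EFinD lee_fin le_eqVlt; apply/orP; left; apply/eqP; field; rewrite gt_eqF.
apply: leeD => //; apply: lee_wpmul2l; first by rewrite lee_fin divr_ge0// ltW.
apply: le_trans F1; rewrite /Fnorm2 (esum_enumT e_bij) [leLHS]esum_mkcond.
apply: le_esum => j _; rewrite exprMn; case: ifP => // _.
by rewrite lee_fin mulr_ge0// sqr_ge0.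
Qed.

Lemma approx_num_le G n : (0 < n)%N ->
  (approx_num G w n <= (Num.sqrt (fine (tail n.-1)))%:E)%E.
Proof.
(* Rank [< n] leaves room for [n.-1] Fourier terms, so the tail starts at index [n.-1]. *)
move=> n0; apply: le_trans (opnorm_partial_sum_le G n.-1).
apply: ereal_inf_lbound; exists (partial_sum n.-1) => //.
by apply: partial_sum_admissible; rewrite prednK.
Qed.

End upper_bound.

(** * Distance from a diagonal matrix to low-rank matrices *)

Section low_rank_distance.
Variable C : numClosedFieldType.
Local Open Scope sesquilinear_scope.

Lemma mxtrace_mulmx_tc m n (X : 'M[C]_(m, n)) :
  \tr (X *m X ^t*) = \sum_i \sum_j `|X i j| ^+ 2.
Proof.
apply: eq_bigr => i _; rewrite mxE; apply: eq_bigr => j _.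
by rewrite !mxE normCK.
Qed.

Lemma mxtrace_mulmx_tc_ge0 m n (X : 'M[C]_(m, n)) : 0 <= \tr (X *m X ^t*).
Proof.
by rewrite mxtrace_mulmx_tc; apply: sumr_ge0 => i _; apply: sumr_ge0 => j _; rewrite exprn_ge0.
Qed.

(** Right minus left is the sum of [s k * ((k < m) - q k)]. The bracket is nonnegative for [k < m],
    where [s k >= s m], and nonpositive for [k >= m], where [s k <= s m]. Replacing [s k] by [s m]
    thus only decreases the sum, and makes it 0 because the [q k] add up to [m]. *)
Lemma ler_sum_weights (N m : nat) (s : nat -> C) (q : 'I_N -> C) :
  (forall k, 0 <= s k) -> (forall i j, (i <= j)%N -> s j <= s i) ->
  (forall k, 0 <= q k <= 1) -> \sum_k q k = m%:R -> (m <= N)%N ->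
  \sum_(k < N | (m <= k)%N) s k <= \sum_(k < N) s k * (1 - q k).
Proof.
move=> s0 sd q01 qm mN; rewrite -subr_ge0.
have E : \sum_(k < N) s m * ((k < m)%N%:R - q k) = 0.
  rewrite -mulr_sumr sumrB qm (_ : \sum_(k < N) _ = m%:R) ?subrr ?mulr0//.
  rewrite -natr_sum; congr (_%:R).
  rewrite -big_mkcond/= -(big_ord_widen N (fun=> 1%N) mN).
  by rewrite sum1_card card_ord.
rewrite -[leLHS]E [X in _ - X]big_mkcond -sumrB; apply: ler_sum => k _.
have /andP[q0 q1] := q01 k.
have [km|km] := ltnP k m.
  by rewrite subr0 ler_wpM2r ?subr_ge0// sd// ltnW.
rewrite sub0r mulrN mulrBr mulr1 addrAC subrr sub0r lerN2.
by rewrite ler_wpM2r// sd.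
Qed.

(** Let [P] be the orthogonal projection off a space of dimension [m] containing the rows of [B].
    Multiplication by [P] does not increase the Frobenius norm and kills [A *m B], leaving [D *m P],
    whose squared norm is the sum of [s k ^+ 2 * P k k]. The diagonal of [1 - P] has entries in
    [0, 1] and trace [m], so [ler_sum_weights] concludes. *)
Lemma frobenius_low_rank (N m : nat) (s : nat -> C)
    (A : 'M[C]_(N, m)) (B : 'M[C]_(m, N)) :
  (forall k, 0 <= s k) -> (forall i j, (i <= j)%N -> s j <= s i) ->
  \sum_(k < N | (m <= k)%N) s k ^+ 2 <=
  \sum_(k < N) \sum_(j < N) `|(k == j)%:R * s k - \sum_(i < m) A k i * B i j| ^+ 2.
Proof.
move=> s0 sd.
(* An orthonormal family of [m] rows, needed for the trace to be exactly [m], exists only if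
   [m <= N]; otherwise the left side is an empty sum. *)
have [mN|Nm] := leqP m N; last first.
  rewrite big_pred0; last by move=> k; apply/negbTE; rewrite -ltnNge (ltn_trans (ltn_ord k)).
  by apply: sumr_ge0 => i _; apply: sumr_ge0 => j _; rewrite exprn_ge0.
pose Q := schmidt B.
have QQ : Q *m Q ^t* = 1%:M by apply/unitarymxP; exact: schmidt_unitarymx.
have /submxP[B' BE] : (B <= Q)%MS by exact: schmidt_sub.
pose D : 'M[C]_N := diag_mx (\row_k s k).
pose X := D - A *m B.
have XE : \tr (X *m X ^t*) =
    \sum_(k < N) \sum_(j < N) `|(k == j)%:R * s k - \sum_(i < m) A k i * B i j| ^+ 2.
  rewrite mxtrace_mulmx_tc; apply: eq_bigr => k _; apply: eq_bigr => j _.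
  congr (`|_| ^+ 2); rewrite !mxE mulr_natl; congr (_ - _).
rewrite -XE.
pose P := 1%:M - Q ^t* *m Q.
have tcM m1 n1 p1 (Y : 'M[C]_(m1, n1)) (Z : 'M[C]_(n1, p1)) :
    (Y *m Z) ^t* = Z ^t* *m Y ^t*.
  by rewrite trmx_mul map_mxM.
have tcB m1 n1 (Y Z : 'M[C]_(m1, n1)) : (Y - Z) ^t* = Y ^t* - Z ^t*.
  by rewrite linearB /= map_mxB.
have tcI : (1%:M : 'M[C]_N) ^t* = 1%:M by rewrite trmx1 map_mx1.
have Ptc : P ^t* = P by rewrite /P tcB tcI tcM trmxCK.
have PP : P *m P = P.
  rewrite /P mulmxBl mul1mx mulmxBr mulmx1.
  rewrite -mulmxA (mulmxA Q) QQ mul1mx subrr subr0 //.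
have QP : Q *m P = 0.
  by rewrite /P mulmxBr mulmx1 mulmxA QQ mul1mx subrr.
have XP : X *m P = D *m P.
  by rewrite /X mulmxBl BE -!mulmxA QP !mulmx0 subr0.
have XPX : \tr (X *m X ^t*) = \tr (D *m P *m (D *m P) ^t*) + \tr ((X *m Q ^t*) *m (X *m Q ^t*) ^t*).
  rewrite -XP -mxtraceD !tcM trmxCK Ptc; congr (\tr _).
  rewrite !mulmxA -(mulmxA X P P) PP -(mulmxA X (Q ^t*)) -mulmxDl -mulmxDr.
  by rewrite /P subrK mulmx1.
rewrite XPX; apply: (@le_trans _ _ (\tr (D *m P *m (D *m P) ^t*))); last first.
  by rewrite lerDl mxtrace_mulmx_tc_ge0.
have Dtc : D ^t* = D.
  rewrite /D tr_diag_mx map_diag_mx; congr diag_mx; apply/rowP => k; rewrite !mxE.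
  by apply: CrealP; rewrite realE s0.
have DPD (Y : 'M[C]_N) k : (D *m Y *m D) k k = s k ^+ 2 * Y k k.
  by rewrite mul_mx_diag mul_diag_mx !mxE; ring.
have Pkk k : P k k = 1 - \sum_(i < m) `|Q i k| ^+ 2.
  rewrite !mxE eqxx; congr (_ - _); apply: eq_bigr => i _.
  by rewrite !mxE mulrC normCK.
(* A self-adjoint idempotent has the squared norms of its rows on the diagonal; their nonnegativity
   is the bound [q k <= 1] required of the weights. *)
have Pkk' k : P k k = \sum_(j < N) `|P k j| ^+ 2.
  rewrite -{1}PP -{2}Ptc mxE; apply: eq_bigr => j _.
  by rewrite !mxE normCK.
have -> : \tr (D *m P *m (D *m P) ^t*) = \sum_(k < N) s k ^+ 2 * (1 - \sum_(i < m) `|Q i k| ^+ 2).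
  rewrite tcM Ptc Dtc mulmxA -(mulmxA D P P) PP; apply: eq_bigr => k _.
  by rewrite DPD Pkk.
apply: (ler_sum_weights (s := fun k => s k ^+ 2)) => //.
- by move=> k; rewrite exprn_ge0.
- by move=> i j ij; rewrite lerXn2r ?nnegrE// sd.
- move=> k; apply/andP; split; first by apply: sumr_ge0 => i _; rewrite exprn_ge0.
  rewrite -subr_ge0 -Pkk Pkk'; by apply: sumr_ge0 => j _; rewrite exprn_ge0.
- rewrite exchange_big/= -mxtrace_mulmx_tc QQ mxtrace1 //.
Qed.

End low_rank_distance.

(** * Lower bound *)

Section gaussian_density.
Variable R : realType.

(* Gaussian integer vectors form a countable family, and by homogeneity they are
   as good as a dense one. *)
Definition gaussian (u : int * int) : R[i] := Complex u.1%:~R u.2%:~R.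

Lemma cvg_sumr I (r : seq I) (f : I -> nat -> R) (l : I -> R) :
  (forall i, f i @ \oo --> l i) ->
  (fun M => \sum_(i <- r) f i M) @ \oo --> \sum_(i <- r) l i.
Proof.
move=> fl; elim: r => [|i r IH].
  by rewrite big_nil; under eq_fun do rewrite big_nil; exact: cvg_cst.
by rewrite big_cons; under eq_fun do rewrite big_cons; exact: cvgD.
Qed.

Lemma cvg_floor_div (t : R) :
  (fun M => (Num.floor (t * M.+1%:R))%:~R / M.+1%:R) @ \oo --> t.
Proof.
have h : (fun M => t - harmonic M) @ \oo --> t - 0.
  by apply: cvgB; [exact: cvg_cst|exact: cvg_harmonic].
rewrite subr0 in h; apply: (squeeze_cvgr _ h (cvg_cst t)).
apply: nearW => M; have M0 : 0 < M.+1%:R :> R by [].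
apply/andP; split; last by rewrite ler_pdivrMr// floor_le.
rewrite ler_pdivlMr// /harmonic mulrBl mulVf ?gt_eqF// lerBlDr.
by have := floorD1_gt (t * M.+1%:R); rewrite rmorphD/= => /ltW.
Qed.

(** Testing with the conjugate of [y] would give [S * S <= V * S] for the sum [S]. The Gaussian
    integer vector obtained by rounding [M.+1] times this conjugate is tested instead; both sides
    are homogeneous of degree 2, so dividing by [M.+1%:R ^+ 2] and letting [M] grow yields the same
    inequality. *)
Lemma sum_cabs_sqr_le (N : nat) (y : 'I_N -> R[i]) (V : R) : 0 <= V ->
  (forall u : 'I_N -> int * int,
    cabs (\sum_k gaussian (u k) * y k) ^+ 2 <= V * \sum_k cabs (gaussian (u k)) ^+ 2) ->
  \sum_k cabs (y k) ^+ 2 <= V.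
Proof.
move=> V0 H.
pose fl (t : R) M : R := (Num.floor (t * M.+1%:R))%:~R / M.+1%:R.
pose a k := complex.Re (y k); pose b k := - complex.Im (y k).
pose S := \sum_k cabs (y k) ^+ 2.
have SE : S = \sum_k (a k * a k + b k * b k).
  by apply: eq_bigr => k _; rewrite cabs_sqr /b mulrNN !expr2.
pose L M := \sum_k (fl (a k) M * a k + fl (b k) M * b k).
pose Q M := \sum_k (fl (a k) M * fl (a k) M + fl (b k) M * fl (b k) M).
have cL : L @ \oo --> S.
  by rewrite SE; apply: cvg_sumr => k; apply: cvgD; apply: cvgM;
    [exact: cvg_floor_div|exact: cvg_cst|exact: cvg_floor_div|exact: cvg_cst].
have cQ : Q @ \oo --> S.
  by rewrite SE; apply: cvg_sumr => k; apply: cvgD; apply: cvgM; exact: cvg_floor_div.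
have LQ M : L M ^+ 2 <= V * Q M.
  have M0 : M.+1%:R != 0 :> R by [].
  have := H (fun k => (Num.floor (a k * M.+1%:R), Num.floor (b k * M.+1%:R))).
  set z := \sum_k _; set q := \sum_k _ => zq.
  have zE : complex.Re z = M.+1%:R * L M.
    rewrite /z Re_sum mulr_sumr; apply: eq_bigr => k _.
    by rewrite ReM/= /fl /a /b; field.
  have qE : q = M.+1%:R ^+ 2 * Q M.
    rewrite /q mulr_sumr; apply: eq_bigr => k _.
    by rewrite cabs_sqr/= /fl; field.
  have : (M.+1%:R * L M) ^+ 2 <= V * (M.+1%:R ^+ 2 * Q M).
    by rewrite -zE -qE (le_trans _ zq)// cabs_sqr lerDl sqr_ge0.
  by rewrite exprMn [leRHS]mulrCA ler_pM2l// exprn_gt0.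
have c1 : (fun M => L M ^+ 2) @ \oo --> S * S.
  by under eq_fun do rewrite expr2; exact: cvgM.
have c2 : (fun M => V * Q M) @ \oo --> V * S.
  by apply: cvgM => //; exact: cvg_cst.
have : S * S <= V * S by apply: (ler_cvg_to c1 c2); exact: nearW.
have S0 : 0 <= S by apply: sumr_ge0 => k _; exact: sqr_ge0.
rewrite -/S; move: S0; rewrite le_eqVlt => /orP[/eqP <- //|S0].
by rewrite ler_pM2r.
Qed.

Lemma frobenius_low_rank_cabs (N m : nat) (s : nat -> R)
    (a : 'I_N -> 'I_m -> R[i]) (b : 'I_m -> 'I_N -> R[i]) :
  (forall k, 0 <= s k) -> (forall i j, (i <= j)%N -> s j <= s i) ->
  \sum_(k < N | (m <= k)%N) s k ^+ 2 <=
  \sum_(k < N) \sum_(j < N)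
    cabs ((k == j)%:R * (s k)%:C%C - \sum_(i < m) a k i * b i j) ^+ 2.
Proof.
move=> s0 sd; rewrite -lecR.
have h := @frobenius_low_rank R[i] N m (fun k => (s k)%:C%C)
  (\matrix_(k, i) a k i) (\matrix_(i, j) b i j).
rewrite !rmorph_sum/=.
under eq_bigr do rewrite rmorphXn/=.
apply: (le_trans (h _ _)) => [k|i j ij|]; [by rewrite ler0c|by rewrite lecR sd|].
rewrite le_eqVlt; apply/orP; left; apply/eqP; apply: eq_bigr => k _.
rewrite rmorph_sum/=; apply: eq_bigr => j _.
rewrite rmorphXn/= /cabs -normc_def.
by congr (`|_ - _| ^+ 2); apply: eq_bigr => i _; rewrite !mxE.
Qed.

End gaussian_density.

Section ae_facts.
Variables (R : realType) (d : nat).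
Local Notation T := (pt R d).
Local Notation mu := (@tmeas R d).

Lemma Linfnorm_ae (f : T -> R[i]) (r : R) : (Linfnorm f <= r%:E)%E ->
  {ae mu, forall x, cabs (f x) <= r}.
Proof.
by move=> /ess_supP; apply: filterS => x; rewrite lee_fin.
Qed.

(** A negative essential bound for a modulus could hold nowhere, which would make the whole torus
    negligible although its mass is 1. *)
Lemma Linfnorm_ge0 (f : T -> R[i]) : (0 <= Linfnorm f)%E.
Proof.
apply: le_ereal_inf_tmp => y fy; rewrite leNgt; apply/negP => y0.
have : mu.-negligible [set: T].
  apply: (negligibleS _ fy) => x _ /= fx.
  have := le_lt_trans fx y0; rewrite lte_fin ltNge cabs_ge0 //.
move=> [A [mA A0 TA]].
have : (mu [set: T] <= mu A)%E by apply: le_measure; rewrite ?inE.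
by rewrite A0 [X in (X <= _)%E]probability_setT lee_fin ler10.
Qed.

Lemma Rintegral_ae_le (h : T -> R) (r : R) : mu.-integrable setT (EFin \o h) ->
  {ae mu, forall x, h x <= r} -> \int[mu]_x h x <= r.
Proof.
move=> ih hr.
have ir : mu.-integrable setT (EFin \o cst r) by exact: finite_measure_integrable_cst.
have mh : measurable_fun setT h by apply/measurable_EFinP; exact: (measurable_int mu).
(* [g] equals [h] almost everywhere and is at most [r] at every point, as the monotonicity of the
   integral requires. *)
pose g x := Num.min (h x) r.
have mg : measurable_fun setT g by exact: measurable_minr.
have ig : mu.-integrable setT (EFin \o g).
  have is_ := integrableD measurableT (integrable_abse ih) (integrable_abse ir).
  apply: (le_integrable measurableT _ _ is_); first by apply/measurable_EFinP.
  move=> x _ /=; rewrite lee_fin [leRHS]ger0_norm ?addr_ge0//.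
  by rewrite /g minEle; case: ifP => _; [rewrite lerDl|rewrite lerDr]; exact: normr_ge0.
rewrite [leLHS](_ : _ = \int[mu]_x g x).
  rewrite -[leRHS](Rintegral_prob_cst mu); apply: le_Rintegral => // x _.
  by rewrite /g ge_min lexx orbT.
rewrite /Rintegral; congr fine; apply: ae_eq_integral => //.
- exact: (measurable_int mu).
- exact: (measurable_int mu).
- by apply: filterS hr => x hx _; rewrite /g min_l.
Qed.

(** The right side minus the left is [|g - p|^2]. *)
Lemma Re_mulJ_le (g p : R[i]) :
  complex.Re ((2 * g - p) * conjc p) <= cabs g ^+ 2.
Proof.
rewrite cabs_sqr -subr_ge0.
case: g p => [a b] [c e] /=.
rewrite [X in 0 <= X](_ : _ = (a - c) ^+ 2 + (b - e) ^+ 2); last by ring.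
by rewrite addr_ge0// sqr_ge0.
Qed.

End ae_facts.

Section lower_bound.
Variables (R : realType) (d : nat) (w : freq d -> R) (e : nat -> freq d).
Hypotheses (w_pos : forall k, 0 < w k) (e_bij : bijective e).
Hypothesis e_noninc : forall i j : nat, (i <= j)%N -> (w (e j))^-1 <= (w (e i))^-1.
Local Notation T := (pt R d).
Local Notation mu := (@tmeas R d).
Implicit Types f g : T -> R[i].

Lemma cint_mul_conj_trigpoly N (c : nat -> R[i]) g : L1 g ->
  cint (fun x => g x * conjc (trigpoly e N c x)) =
  \sum_(j < N) conjc (c j) * fhat g (e j).
Proof.
move=> g1.
transitivity (cint (fun x => \sum_(j < N) conjc (c j) * (g x * cexpm (e j) x))).
  apply: eq_cint => x; rewrite /trigpoly rmorph_sum mulr_sumr/=.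
  apply: eq_bigr => j _; rewrite rmorphM/= mulrCA; congr (_ * (_ * _)).
rewrite cint_sum; last by move=> j; apply: L1Z; exact: L1M_cexpm.
by apply: eq_bigr => j _; rewrite cintZ//; exact: L1M_cexpm.
Qed.

Definition sigma j : R := (w (e j))^-1.

Lemma sigma_gt0 j : 0 < sigma j.
Proof. by rewrite invr_gt0. Qed.

(** The combination with coefficients [u] of the orthonormal basis of [F_d(w)]: the factor [sigma j]
    cancels the weight, so the squared norm is that of [u]. *)
Definition wpoly (N : nat) (u : nat -> R[i]) : T -> R[i] :=
  trigpoly e N (fun j => u j * (sigma j)%:C%C).

Lemma cabs_real (a : R) : 0 <= a -> cabs (a%:C%C) = a.
Proof. by move=> a0; rewrite /cabs/= expr0n addr0 sqrtr_sqr ger0_norm. Qed.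

Lemma Fnorm2_wpoly N u : Fnorm2 w (wpoly N u) = (\sum_(j < N) cabs (u j) ^+ 2)%:E.
Proof.
rewrite /Fnorm2 (esum_enumT e_bij).
transitivity (\esum_(j in `I_N) (cabs (u j) ^+ 2)%:E)%E.
  rewrite [RHS]esum_mkcond; apply: eq_esum => j _; rewrite (fhat_trigpoly e_bij).
  case: ifPn => jN.
    rewrite mem_set// cabsM cabs_real ?(ltW (sigma_gt0 j))// /sigma exprMn mulrCA -exprMn.
    by rewrite mulfV ?gt_eqF// expr1n mulr1.
  by rewrite memNset ?cabs0 ?expr0n ?mulr0//=; exact/negP.
rewrite esum_fset//; last by move=> j _; rewrite lee_fin sqr_ge0.
by rewrite -fsbig_ord sumEFin.
Qed.

Lemma inF_wpoly N u : inF w (wpoly N u).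
Proof. by split; [exact: L1_trigpoly|rewrite Fnorm2_wpoly ltry]. Qed.

Lemma inG_L1 G f : inG G f -> L1 f.
Proof. by case: G => -[]. Qed.

(** * Bounds for a fixed operator of rank less than [n] *)

Section operator.
Variables (G : Gspace) (n : nat) (A : (T -> R[i]) -> (T -> R[i])).
Hypothesis adm : admissible G w n A.
Variable r : R.
Hypothesis op_le : (opnorm_IminusA G w A <= r%:E)%E.

(** Written as a [wpoly] with a unit coefficient vector, so that the facts about [wpoly] apply to it
    directly; [basis_funE] gives the explicit form. *)
Definition basis_fun (j : nat) : T -> R[i] := wpoly j.+1 (fun i => (i == j)%:R).

Lemma basis_funE j x : basis_fun j x = (sigma j)%:C%C * cexpp (e j) x.
Proof.
rewrite /basis_fun /wpoly /trigpoly big_ord_recr/= eqxx mul1r big1 ?add0r// => i _.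
by rewrite (ltn_eqF (ltn_ord i)) !mul0r.
Qed.

Definition residual (j : nat) : T -> R[i] := fun x => basis_fun j x - A (basis_fun j) x.

Lemma L1_A f : inF w f -> L1 (A f).
Proof. by case: adm => h _ _ _ _ /h; exact: inG_L1. Qed.

Lemma L1_residual j : L1 (residual j).
Proof. by apply: L1B; [exact: L1_trigpoly|apply: L1_A; exact: inF_wpoly]. Qed.

Lemma A_wpoly_ae N u :
  Defs.ae_eq (fun x => wpoly N u x - A (wpoly N u) x)
             (fun x => \sum_(j < N) u j * residual j x).
Proof.
have [_ _ lin _ _] := adm.
elim: N => [|N IH].
  (* Linearity is available only in the form [f + c * g]; from [0 = 0 + 1 * 0] it follows that [A]
     sends 0 to 0 almost everywhere. *)
  have E : wpoly 0 u = (fun x => wpoly 0 u x + 1 * wpoly 0 u x).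
    by apply/funext => x; rewrite /wpoly /trigpoly !big_ord0 mulr0 addr0.
  have := lin _ _ 1 (inF_wpoly 0 u) (inF_wpoly 0 u); rewrite -E.
  apply: filterS => x /eqP; rewrite -subr_eq0 opprD addNKr mul1r oppr_eq0 => /eqP ->.
  by rewrite /wpoly /trigpoly !big_ord0 subrr.
have E : wpoly N.+1 u = (fun x => wpoly N u x + u N * basis_fun N x).
  by apply/funext => x; rewrite basis_funE mulrA /wpoly /trigpoly big_ord_recr.
have := lin _ _ (u N) (inF_wpoly N u) (inF_wpoly N.+1 (fun i => (i == N)%:R)).
rewrite -/(basis_fun N) -E; apply: filterS2 IH => x IH lx.
by rewrite big_ord_recr/= -IH lx E /residual; ring.
Qed.

Lemma residual_ae_le N (u : nat -> R[i]) :
  {ae mu, forall x, cabs (\sum_(j < N) u j * residual j x) ^+ 2 <=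
    r ^+ 2 * \sum_(j < N) cabs (u j) ^+ 2}.
Proof.
set S := \sum_(j < N) cabs (u j) ^+ 2.
have S0 : 0 <= S by apply: sumr_ge0 => j _; exact: sqr_ge0.
have [SE|Sn] := eqVneq S 0.
  apply: aeW => x; rewrite SE mulr0 big1 ?cabs0 ?expr0n// => j _.
  have /eqP := SE; rewrite psumr_eq0; last by move=> i _; exact: sqr_ge0.
  move=> /allP/(_ j (mem_index_enum _)); rewrite sqrf_eq0 => /eqP uj0.
  by rewrite (_ : u j = 0) ?mul0r//; apply: eq0_normc; rewrite -cabsE.
pose t := Num.sqrt S.
have t0 : 0 < t by rewrite sqrtr_gt0 lt_neqAle eq_sym Sn.
have t2 : t ^+ 2 = S by rewrite sqr_sqrtr.
pose u' j := (t^-1)%:C%C * u j.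
have F1 : Fnorm2 w (wpoly N u') = 1%E.
  rewrite Fnorm2_wpoly; congr EFin.
  under eq_bigr do rewrite cabsM cabs_real ?invr_ge0 ?ltW// exprMn.
  by rewrite -mulr_sumr -/S exprVn t2 mulVf.
have op1 : (Linfnorm (fun x => wpoly N u' x - A (wpoly N u') x)%R <= r%:E)%E.
  apply: (le_trans _ op_le); apply: le_trans.
    apply: (Linfnorm_le_Gnorm e_bij G).
    by apply: L1B; [exact: L1_trigpoly|apply: L1_A; exact: inF_wpoly].
  apply: ereal_sup_ubound; exists (wpoly N u') => //; split; first exact: inF_wpoly.
  by rewrite /Fnorm F1 ltry/= sqrtr1.
apply: filterS2 (Linfnorm_ae op1) (A_wpoly_ae N u') => x xr xE.
rewrite xE in xr.
have -> : \sum_(j < N) u j * residual j x = t%:C%C * \sum_(j < N) u' j * residual j x.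
  rewrite mulr_sumr; apply: eq_bigr => j _; rewrite /u' !mulrA -rmorphM/=.
  by rewrite mulfV ?gt_eqF// mul1r.
rewrite cabsM (cabs_real (ltW t0)) exprMn t2 [leRHS]mulrC ler_wpM2l//.
by rewrite ler_sqr ?nnegrE ?cabs_ge0// (le_trans _ xr) ?cabs_ge0.
Qed.

Lemma sum_residual_ae_le N :
  {ae mu, forall x, \sum_(j < N) cabs (residual j x) ^+ 2 <= r ^+ 2}.
Proof.
have Huv (v : {ffun 'I_N -> int * int}) : {ae mu, forall x,
    cabs (\sum_(j < N) gaussian R (v j) * residual j x) ^+ 2 <=
    r ^+ 2 * \sum_(j < N) cabs (gaussian R (v j)) ^+ 2}.
  pose u j := if insub j is Some k then gaussian R (v k) else 0.
  have uE (k : 'I_N) : u k = gaussian R (v k) by rewrite /u valK.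
  have := residual_ae_le N u; apply: filterS => x.
  by under eq_bigr do rewrite uE; under [X in _ <= _ * X]eq_bigr do rewrite uE.
(* The Gaussian vectors are enumerated by their codes, so that countably many null sets are merged
   into one; a number that is no code imposes no condition. *)
have : {ae mu, forall x, forall m,
    if unpickle m is Some v then
    cabs (\sum_(j < N) gaussian R ((v : {ffun 'I_N -> int * int}) j) * residual j x) ^+ 2 <=
    r ^+ 2 * \sum_(j < N) cabs (gaussian R (v j)) ^+ 2 else true}.
  apply/ae_foralln => m; case: (unpickle m) => [v|]; [exact: Huv|exact: aeW].
apply: filterS => x H; apply: sum_cabs_sqr_le; first exact: sqr_ge0.
move=> u; have := H (pickle [ffun k => u k]); rewrite pickleK.
by under eq_bigr do rewrite ffunE; under [X in _ <= _ * X]eq_bigr do rewrite ffunE.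
Qed.

(* Bessel's inequality without square integrability: with [p] the partial Fourier
   sum of [g], integrate the pointwise bound [2 Re (g p^* ) - |p|^2 <= |g|^2]. *)
Lemma sum_fhat_residual_le N :
  \sum_(k < N) \sum_(j < N) cabs (fhat (residual k) (e j)) ^+ 2 <= r ^+ 2.
Proof.
pose t (k j : nat) := fhat (residual k) (e j).
pose p k := trigpoly e N (t k).
(* The first [N] coefficients of [q k] are [2 * t k j - t k j = t k j], so the integral of [q k]
   times the conjugate of [p k] is the sum of the [|t k j|^2]. *)
pose q k x := 2 * residual k x - p k x.
have q1 k : L1 (q k) by apply: L1B; [apply: L1Z; exact: L1_residual|exact: L1_trigpoly].
have p_bounded k : exists M, forall x, cabs (conjc (p k x)) <= M.
  exists (\sum_(j < N) cabs (t k j)) => x.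
  have -> : cabs (conjc (p k x)) = cabs (p k x).
    by rewrite /cabs; case: (p k x) => a b /=; rewrite sqrrN.
  apply: (le_trans (ler_cabs_sum _ _ _)); apply: ler_sum => j _.
  by rewrite cabsM cabs_cexpp mulr1.
have mp k : cmeasurable (fun x => conjc (p k x)).
  have [mr mi] := L1_cmeasurable (L1_trigpoly e N (t k)).
  split.
    by rewrite (_ : (fun x => _) = (fun x => complex.Re (p k x)))//;
      apply/funext => x; case: (p k x).
  rewrite (_ : (fun x => _) = (\- (fun x => complex.Im (p k x)))); last first.
    by apply/funext => x /=; case: (p k x).
  exact: measurable_funN.
have qp1 k : L1 (fun x => q k x * conjc (p k x)).
  by have [M pM] := p_bounded k; exact: L1M_bounded (q1 k) (mp k) pM.
have E : \sum_(k < N) \sum_(j < N) cabs (t k j) ^+ 2 =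
    complex.Re (cint (fun x => \sum_(k < N) q k x * conjc (p k x))).
  rewrite cint_sum// Re_sum; apply: eq_bigr => k _.
  rewrite cint_mul_conj_trigpoly// Re_sum; apply: eq_bigr => j _.
  have -> : fhat (q k) (e j) = t k j.
    rewrite /q fhatB; [|apply: L1Z; exact: L1_residual|exact: L1_trigpoly].
    rewrite fhatZ; last exact: L1_residual.
    by rewrite (fhat_trigpoly e_bij) ltn_ord -/(t k j); ring.
  by rewrite cabs_sqr; case: (t k j) => a b /=; ring.
rewrite -/t [leLHS]E; apply: Rintegral_ae_le.
  by have /L1P[] := @L1_sum R d _ (index_enum 'I_N) xpredT _ qp1.
apply: filterS (sum_residual_ae_le N) => x; apply: le_trans.
by rewrite Re_sum; apply: ler_sum => k _; exact: Re_mulJ_le.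
Qed.

Lemma sum_sigma_le N :
  \sum_(k < N | (n.-1 <= k)%N) sigma k ^+ 2 <= r ^+ 2.
Proof.
have [_ _ _ _ [m mn [gs [gsG AE]]]] := adm.
have gs1 i : L1 (gs i) by exact: inG_L1 (gsG i).
have /choice[c cE] : forall k, exists c : 'I_m -> R[i],
    Defs.ae_eq (A (basis_fun k)) (fun x => \sum_(i < m) c i * gs i x).
  by move=> k; apply: AE; exact: inF_wpoly.
apply: le_trans (sum_fhat_residual_le N).
have mn' : (m <= n.-1)%N by case: n mn.
apply: (@le_trans _ _ (\sum_(k < N | (m <= k)%N) sigma k ^+ 2)).
  rewrite big_mkcond [leRHS]big_mkcond; apply: ler_sum => k _.
  case: ifPn => nk; first by rewrite (leq_trans mn' nk).
  by case: ifP => // _; exact: sqr_ge0.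
(* The coefficients of [A (basis_fun k)] are the product of the matrix [c] and the matrix of
   coefficients of the [gs i], with inner dimension [m]. *)
apply: (le_trans (frobenius_low_rank_cabs (fun k i => c k i) (fun i j => fhat (gs i) (e j)) _ _)).
- by move=> k; exact: ltW (sigma_gt0 k).
- exact: e_noninc.
rewrite le_eqVlt; apply/orP; left; apply/eqP; apply: eq_bigr => k _; apply: eq_bigr => j _.
congr (cabs _ ^+ 2).
have Lg : L1 (fun x => \sum_(i < m) c k i * gs i x) by apply: L1_sum => i; exact: L1Z.
have LA : L1 (A (basis_fun k)) by apply: L1_A; exact: inF_wpoly.
rewrite /residual fhatB//; last exact: L1_trigpoly.
rewrite (fhat_ae _ LA Lg (cE k)).
rewrite (fhat_sum (F := fun i x => c k i * gs i x) _ _ _ (fun i => L1Z (c k i) (gs1 i))).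
congr (_ - _); last by apply: eq_bigr => i _; rewrite fhatZ.
rewrite (_ : basis_fun k = (fun x => (sigma k)%:C%C * cexpp (e k) x)); last by apply/funext => x; exact: basis_funE.
rewrite fhatZ; last exact: L1_cexpp.
by rewrite fhat_cexpp (inj_eq (bij_inj e_bij)) mulrC.
Qed.

Lemma tail_le : (\esum_(j in [set j : nat | (n.-1 <= j)%N]) ((w (e j)) ^-2)%:E <= (r ^+ 2)%:E)%E.
Proof.
have wj j : (0 <= ((w (e j)) ^-2)%:E)%E by rewrite lee_fin invr_ge0 sqr_ge0.
rewrite -(@nneseries_esum _ _ (fun j => (n.-1 <= j)%N))//.
apply: lime_le; first by apply: is_cvg_nneseries_cond => j _ _; exact: wj.
apply: nearW => N; rewrite sumEFin lee_fin big_mkord (le_trans _ (sum_sigma_le N))//.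
by apply: ler_sum => j _; rewrite /sigma exprVn.
Qed.

End operator.

Lemma approx_num_ge G n :
  ((Num.sqrt (fine (\esum_(j in [set j : nat | (n.-1 <= j)%N]) ((w (e j)) ^-2)%:E)%E))%:E
  <= approx_num G w n)%E.
Proof.
apply: le_ereal_inf_tmp => _ [A adm <-].
(* Tested on the zero function. This excludes the value [-oo] of the supremum and makes [r]
   nonnegative, so that the square root of [r ^+ 2] is [r]. *)
have op0 : (0 <= opnorm_IminusA G w A)%E.
  apply: (@le_trans _ _ (Gnorm G (fun x => wpoly 0 (fun=> 0) x - A (wpoly 0 (fun=> 0)) x)%R)).
    apply: (le_trans (Linfnorm_ge0 _)); apply: (Linfnorm_le_Gnorm e_bij G).
    by apply: L1B; [exact: L1_trigpoly|apply: (L1_A adm); exact: inF_wpoly].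
  apply: ereal_sup_ubound; exists (wpoly 0 (fun=> 0)) => //; split; first exact: inF_wpoly.
  by rewrite /Fnorm Fnorm2_wpoly ltry/= big_ord0 sqrtr0.
case E : (opnorm_IminusA G w A) op0 => [r||] // r0; last by rewrite leey.
have Er : (opnorm_IminusA G w A <= r%:E)%E by rewrite E.
have := tail_le adm Er; set tl := (\esum_(j in _) _)%E => tr.
have tl0 : (0 <= tl)%E by apply: esum_ge0 => j _; rewrite lee_fin invr_ge0 sqr_ge0.
have fin : tl \is a fin_num by rewrite ge0_fin_numE // (le_lt_trans tr) // ltry.
have r0' : 0 <= r by rewrite -lee_fin.
rewrite lee_fin -[leRHS](ger0_norm r0') -sqrtr_sqr ler_wsqrtr//.
by rewrite -lee_fin fineK.
Qed.

End lower_bound.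

(* sigma_j = 1 / w (e (j-1)), j >= 1, is the non-increasing rearrangement of
   (1/w(k))_k, where e : nat -> Z^d is a bijection; the claim
   a_n = (sum_{j >= n} sigma_j^2)^{1/2} (n >= 1) reads, in 0-based indexing of e,
   a_n = (sum_{j >= n-1} w(e j)^{-2})^{1/2}. *)
Theorem theorem2 (R : realType) (d : nat) (w : freq d -> R)
  (w_pos : forall k, 0 < w k)
  (w_sum : (\esum_(k in [set: freq d]) ((w k) ^-2)%:E < +oo)%E)
  (e : nat -> freq d) (e_bij : bijective e)
  (e_noninc : forall i j : nat, (i <= j)%N -> (w (e j))^-1 <= (w (e i))^-1)
  (G : Gspace) (n : nat) (n_pos : (0 < n)%N) :
  approx_num G w n =
  (Num.sqrt (fine (\esum_(j in [set j : nat | (n.-1 <= j)%N]) ((w (e j)) ^-2)%:E)%E))%:E.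
Proof.
apply/eqP; rewrite eq_le; apply/andP; split.
- exact: approx_num_le.
- exact: approx_num_ge.
Qed.
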